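(* (Whitehead theorem in $\mathbf{E}_*$.) A map in $\mathbf{E}_*$ between objects that are both cofibrant and fibrant in $\mathbf{E}_*$ is a weak equivalence if and only if it is an exterior homotopy equivalence under $\mathbb{R}_+$.
   Context: All topological spaces are compactly generated and weakly Hausdorff. An exterior space is a topological space $X$ with a nonempty family $\mathcal{E}$ of open subsets (exterior sets), closed under finite intersections and such that every open set containing a member of $\mathcal{E}$ is in $\mathcal{E}$. A continuous map is exterior if preimages of exterior sets are exterior. $\mathbf{E}$ is the category of exterior spaces and exterior maps. The cocompact externology consists of complements of closed compact subsets; $\mathbb{R}_+=[0,\infty)$ and $\mathbb{N}=\{0,1,2,\dots\}$ carry it. For an exterior space $X$ and a topological space $Y$, $X\bar\times Y$ is $X\times Y$ with exterior sets those open sets $W$ such that for each $y\in Y$ there are an exterior set $F$ of $X$ and an open neighbourhood $U$ of $y$ with $F\times U\subset W$. With $I=[0,1]$, an exterior homotopy is an exterior map $X\bar\times I\to Y$; $[X,Y]$ is the set of exterior homotopy classes. For $n\ge0$ put $\mathcal{S}^n=\mathbb{N}\bar\times S^n$, $\mathcal{D}^n=\mathbb{N}\bar\times D^n$, $\mathcal{C}^n=\mathbb{N}\bar\times(D^n\times I)$, $\mathcal{S}^{-1}=\varnothing$. A discrete ray is an exterior map $\alpha\colon\mathbb{N}\to X$; $\pi_n^e(X,\alpha)$ is the set of exterior homotopy classes relative to $\mathbb{N}$ of exterior maps $g\colon\mathcal{S}^n\to X$ with $g(m,x_0)=\alpha(m)$ ($x_0\in S^n$ the base point), a group for $n\ge1$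 in the usual sphere-wise way. The exterior model structure on $\mathbf{E}$ is the cofibrantly generated one with weak equivalences the exterior maps inducing a bijection on $[\mathbb{N},-]$ and isomorphisms on $\pi_n^e$ for all $n\ge1$ and all discrete rays, generating cofibrations $\{\mathcal{S}^{n-1}\to\mathcal{D}^n\}_{n\ge0}$ and generating trivial cofibrations $\{\mathcal{D}^n\to\mathcal{C}^n\}_{n\ge0}$. $\mathbf{E}_*$ has as objects diagrams $\mathbb{R}_+\xrightarrow{s}X\xrightarrow{r}\mathbb{R}_+$ in $\mathbf{E}$ with $rs=\mathrm{id}$, and as morphisms the exterior maps commuting with sections and retractions. Its model structure is the one in which a map is a fibration, cofibration or weak equivalence iff it is so in $\mathbf{E}$. An exterior homotopy equivalence under $\mathbb{R}_+$ is an exterior map $f\colon X\to Y$ commuting with the sections for which there is an exterior map $g\colon Y\to X$ commuting with the sections such that $gf$ and $fg$ are exteriorly homotopic to the identities through exterior homotopies all of whose stages commute with the sections (no compatibility of $g$ or of the homotopies with the retractions is required). *)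

(* Defs.v *)
From HB Require Import structures.
From mathcomp Require Import all_boot all_order all_algebra.
From mathcomp Require Import all_classical all_reals all_analysis.
From mathcomp Require Import ring.

Set Implicit Arguments.
Unset Strict Implicit.
Unset Printing Implicit Defensive.

Import Order.TTheory GRing.Theory Num.Theory.
Import numFieldNormedType.Exports.
Local Open Scope classical_set_scope.
Local Open Scope ring_scope.

Definition compactly_generated (T : topologicalType) : Prop :=
  forall A : set T,
    (forall (K : topologicalType) (u : K -> T),
       compact [set: K] -> hausdorff_space K -> continuous u ->
       closed (u @^-1` A)) ->
    closed A.

Definition weakly_hausdorff (T : topologicalType) : Prop :=
  forall (K : topologicalType) (u : K -> T),
    compact [set: K] -> hausdorff_space K -> continuous u -> closed (range u).

Definition CGWH (T : topologicalType) : Prop :=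
  compactly_generated T /\ weakly_hausdorff T.

Lemma set_val_hausdorff (T : topologicalType) (A : set T) :
  hausdorff_space T -> hausdorff_space (set_type A).
Proof.
move=> hT x y xy; apply/val_inj/hT => U V xU yV.
have [z [Uz Vz]] := xy _ _ (@initial_continuous _ _ set_val x _ xU)
  (@initial_continuous _ _ set_val y _ yV).
by exists (set_val z).
Qed.

Lemma compact_set_type (T : topologicalType) (A : set T) (a : A) :
  compact A -> compact [set: set_type A].
Proof.
move=> cA; pose f (t : T) : set_type A := insubd a t.
have -> : [set: set_type A] = f @` A.
  apply/seteqP; split => // x _; exists (set_val x); first exact: set_valP.
  by apply: val_inj; rewrite /f val_insubd (valP x).
apply: continuous_compact cA; apply/subspace_sigL_continuousP.
have -> : sigL A f = id by apply/funext => x; rewrite /sigL /= /f valKd.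
by move=> x; exact: cvg_id.
Qed.

Lemma locally_compact_CGWH (T : topologicalType) :
  hausdorff_space T ->
  (forall x : T, exists2 K : set T, nbhs x K & compact K) -> CGWH T.
Proof.
move=> hT lcT; split=> [A kA x clAx|K u cK hK uc]; last first.
  apply: compact_closed => //; apply: continuous_compact cK.
  exact: continuous_subspaceT.
have [K xK cK] := lcT x.
pose k : set_type K := exist _ x (mem_set (nbhs_singleton xK)).
have /(_ k) := kA (set_type K) set_val (compact_set_type k cK)
  (@set_val_hausdorff _ _ hT) (@initial_continuous _ _ set_val).
apply=> V /= [W [[B oB BW] Wx sV]]; rewrite -{}BW in Wx sV.
have [y [Ay [By Ky]]] : A `&` (B `&` K) !=set0.
  by apply: clAx; apply: filterI => //; apply: open_nbhs_nbhs; split.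
pose y' : set_type K := exist _ y (mem_set Ky).
by exists y'; split => //; exact: sV.
Qed.

Record extSpace := ExtSpace {
  ext_carrier :> topologicalType;
  exterior : set (set ext_carrier);
  exterior_nonempty : exterior !=set0;
  exterior_open : forall A, exterior A -> open A;
  exteriorI : forall A B, exterior A -> exterior B -> exterior (A `&` B);
  exterior_up : forall A B, exterior A -> open B -> A `<=` B -> exterior B }.

Definition exterior_map (X Y : extSpace) (f : X -> Y) : Prop :=
  continuous f /\ forall A, exterior A -> exterior (f @^-1` A).

Section cocompact.
Variable T : topologicalType.

Definition cocompact_sets : set (set T) :=
  [set ~` K | K in [set K : set T | closed K /\ compact K]].

Lemma cocompact_nonempty : cocompact_sets !=set0.
Proof.
by exists (~` set0); exists set0 => //; split; [exact: closed0|exact: compact0].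
Qed.

Lemma cocompact_open A : cocompact_sets A -> open A.
Proof. by move=> [K [cK _] <-]; exact: closed_openC. Qed.

Lemma cocompactI A B :
  cocompact_sets A -> cocompact_sets B -> cocompact_sets (A `&` B).
Proof.
move=> [K [cK kK] <-] [L [cL kL] <-]; exists (K `|` L); last by rewrite setCU.
by split; [exact: closedU|exact: compactU].
Qed.

Lemma cocompact_up A B :
  cocompact_sets A -> open B -> A `<=` B -> cocompact_sets B.
Proof.
move=> [K [cK kK] <-] oB KB; exists (~` B); last by rewrite setCK.
have cB : closed (~` B) by exact: open_closedC.
split=> //; apply: subclosed_compact cB kK _ => x nBx.
by apply: contrapT => nKx; exact/nBx/KB.
Qed.

Definition cocompact : extSpace :=
  ExtSpace cocompact_nonempty cocompact_open cocompactI cocompact_up.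

End cocompact.

(* The topology on [X * Y] is the ordinary product topology. Below, [Y] is
   always compact Hausdorff, in which case the ordinary product with a compactly
   generated [X] is already compactly generated. *)
Section extprod.
Variables (X : extSpace) (Y : topologicalType).

Definition extprod_sets : set (set (X * Y)) :=
  [set W | open W /\ forall y, exists (F : set X) (U : set Y),
     [/\ exterior F, open U, U y & F `*` U `<=` W]].

Lemma extprod_nonempty : extprod_sets !=set0.
Proof.
exists setT; split=> [|y]; first exact: openT.
by have [F eF] := exterior_nonempty X; exists F, setT; split=> //; exact: openT.
Qed.

Lemma extprod_open W : extprod_sets W -> open W.
Proof. by case. Qed.

Lemma extprodI V W : extprod_sets V -> extprod_sets W -> extprod_sets (V `&` W).
Proof.
move=> [oV eV] [oW eW]; split=> [|y]; first exact: openI.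
have [F [U [eF oU Uy FU]]] := eV y; have [G [U' [eG oU' Uy' GU]]] := eW y.
exists (F `&` G), (U `&` U'); split=> //; [exact: exteriorI|exact: openI|].
by move=> [a b] [[/= Fa Ga] [Ub Ub']]; split; [apply: FU|apply: GU].
Qed.

Lemma extprod_up V W : extprod_sets V -> open W -> V `<=` W -> extprod_sets W.
Proof.
move=> [oV eV] oW VW; split=> // y.
have [F [U [eF oU Uy FU]]] := eV y.
by exists F, U; split=> //; exact: subset_trans VW.
Qed.

Definition extprod : extSpace :=
  ExtSpace extprod_nonempty extprod_open extprodI extprod_up.

End extprod.

Section spaces.
Variable R : realType.

Definition Next : extSpace := cocompact nat.

Definition halfline : set R := [set x | 0 <= x].
Definition Rplus : extSpace := cocompact (set_type halfline).

Definition unitI : topologicalType := set_type (`[0, 1]%classic : set R).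

Lemma unitI0_subproof : (0 : R) \in (`[0, 1]%classic : set R).
Proof. by rewrite inE /= in_itv /= lexx ler01. Qed.
Lemma unitI1_subproof : (1 : R) \in (`[0, 1]%classic : set R).
Proof. by rewrite inE /= in_itv /= lexx ler01. Qed.
Definition unitI0 : unitI := exist _ 0 unitI0_subproof.
Definition unitI1 : unitI := exist _ 1 unitI1_subproof.

Definition sqnorm k (x : 'rV[R]_k) : R := \sum_i x 0 i ^+ 2.

(* [sph k] is the unit sphere of R^k, that is S^(k-1); in particular [sph 0] is
   the empty space S^(-1), and S^n is [sph n.+1]. *)
Definition sph_set k : set 'rV[R]_k := [set x | sqnorm x = 1].
Definition disk_set k : set 'rV[R]_k := [set x | sqnorm x <= 1].
Arguments sph_set : clear implicits.
Arguments disk_set : clear implicits.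
Definition sph k : topologicalType := set_type (sph_set k).
Definition disk k : topologicalType := set_type (disk_set k).

Definition extSph k : extSpace := extprod Next (sph k).
Definition extDisk k : extSpace := extprod Next (disk k).
Definition extCyl k : extSpace := extprod Next (disk k * unitI)%type.

Lemma sph_disk_subproof k (x : sph k) :
  set_val x \in disk_set k.
Proof. by rewrite inE /disk_set /= (set_valP x). Qed.
Definition sph_disk k (x : sph k) : disk k :=
  exist (fun y => y \in disk_set k) _ (sph_disk_subproof x).

Definition extSph_extDisk k (p : extSph k) : extDisk k := (p.1, sph_disk p.2).
Definition extDisk_extCyl k (p : extDisk k) : extCyl k :=
  (p.1, (p.2, unitI0)).

Lemma sph_base_subproof n :
  (delta_mx 0 0 : 'rV[R]_n.+1) \in sph_set n.+1.
Proof.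
rewrite inE /sph_set /= /sqnorm big_ord_recl big1 ?addr0 => [|i _].
  by rewrite mxE !eqxx expr1n.
by rewrite mxE /= expr0n.
Qed.
Definition sph_base n : sph n.+1 :=
  exist (fun y => y \in sph_set n.+1) _ (sph_base_subproof n).

(* Writing a point of S^(m+1) as (x0, y, t), with [t] its last coordinate,
   [pinch] sends it to (1 - 2t^2, 2|t|y, 2t x0). The equator t = 0, which
   contains the base point, is sent to the base point, and each of the two open
   hemispheres is sent homeomorphically, with degree +1, onto the complement of
   the base point. *)
Definition pinch_mx m (x : 'rV[R]_m.+2) : 'rV[R]_m.+2 :=
  let t := x 0 ord_max in
  \row_i (if i == ord0 then 1 - t ^+ 2 *+ 2
          else if i == ord_max then (t * x 0 ord0) *+ 2
          else (`|t| * x 0 i) *+ 2).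

Lemma pinch_subproof m (x : 'rV[R]_m.+2) :
  sph_set m.+2 x -> sph_set m.+2 (pinch_mx x).
Proof.
rewrite /sph_set /= /sqnorm big_ord_recl big_ord_recr /= => hx.
rewrite big_ord_recl big_ord_recr /= !mxE /=.
rewrite (_ : lift ord0 ord_max = ord_max) in hx *; last exact: val_inj.
rewrite eqxx.
set t := x 0 ord_max in hx *; set x0 := x 0 ord0 in hx *.
have -> : \sum_(i < m) pinch_mx x 0 (lift ord0 (widen_ord (leqnSn m) i)) ^+ 2 =
    4 * t ^+ 2 * \sum_(i < m) x 0 (lift ord0 (widen_ord (leqnSn m) i)) ^+ 2.
  rewrite mulr_sumr; apply: eq_bigr => i _; rewrite mxE /= ifF; last first.
    by apply/negbTE; rewrite -val_eqE /= /bump /= add1n eqSS ltn_eqF.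
  rewrite -/t -mulr_natl exprMn exprMn real_normK ?num_real //.
  by rewrite -mulrA -natrX.
move: (\sum_(i < m) _) hx => s hx.
have -> : s = 1 - x0 ^+ 2 - t ^+ 2 by rewrite -hx; ring.
ring.
Qed.
Definition pinch m (x : sph m.+2) : sph m.+2 :=
  exist (fun y => y \in sph_set m.+2) _
    (mem_set (pinch_subproof (set_valP x))).

Lemma Rplus_CGWH : CGWH Rplus.
Proof.
have hR : hausdorff_space R by exact: Rhausdorff.
apply: locally_compact_CGWH => [|x]; first exact: set_val_hausdorff.
have f_subproof (r : R) : Num.max 0 r \in halfline.
  by rewrite inE /halfline /= le_max lexx.
pose f (r : R) : set_type halfline :=
  exist (fun y => y \in halfline) _ (f_subproof r).
exists (f @` `[0, set_val x + 1]).
  exists (set_val @^-1` [set r : R | r < set_val x + 1]).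
  split=> /=; [by exists [set r : R | r < set_val x + 1]; [exact: open_lt|]| |].
    by rewrite ltrDl.
  move=> y /= yx; exists (set_val y).
    by rewrite /= in_itv /= (set_valP y) ltW.
  by apply: val_inj => /=; apply/max_idPr; exact: (set_valP y).
apply: continuous_compact; last exact: segment_compact.
apply: continuous_subspaceT; apply/continuousP => _ [B oB <-].
have -> : f @^-1` (set_val @^-1` B) = (fun r : R => Num.max 0 r) @^-1` B by [].
move: B oB; apply/continuousP => r.
by apply: continuous_max; [exact: cst_continuous|exact: cvg_id].
Qed.

End spaces.

Section homotopy.
Variables (R : realType) (X Y : extSpace).

Definition ext_homotopy (f g : X -> Y) (H : extprod X (unitI R) -> Y) : Prop :=
  [/\ exterior_map H, forall x, H (x, unitI0 R) = f x
    & forall x, H (x, unitI1 R) = g x].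

Definition ext_homotopic (f g : X -> Y) : Prop := exists H, ext_homotopy f g H.

End homotopy.

(* For an equivalence relation [r] on [D], [classes D r] is the quotient D/r,
   and [class_map D' r' phi] is the map from D/r to D'/r' induced by [phi]. *)
Definition classes T (D : set T) (r : T -> T -> Prop) : set (set T) :=
  [set [set y | D y /\ r x y] | x in D].

Definition class_map T T' (D' : set T') (r' : T' -> T' -> Prop) (phi : T -> T')
    (A : set T) : set T' :=
  [set y | D' y /\ exists2 x, A x & r' (phi x) y].

Section homotopy_sets.
Variable R : realType.

Definition htpy_set (X Y : extSpace) : set (set (X -> Y)) :=
  classes (@exterior_map X Y) (@ext_homotopic R X Y).
Arguments htpy_set : clear implicits.

Definition htpy_set_map (W X Y : extSpace) (f : X -> Y) :
    set (W -> X) -> set (W -> Y) :=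
  class_map (@exterior_map W Y) (@ext_homotopic R W Y)
    (fun g : W -> X => f \o g).

Section pi.
Variables (X : extSpace) (n : nat) (alpha : Next -> X).

Definition based_map (g : extSph R n.+1 -> X) : Prop :=
  exterior_map g /\ forall m, g (m, sph_base R n) = alpha m.

Definition based_homotopic (g h : extSph R n.+1 -> X) : Prop :=
  exists2 H : extprod (extSph R n.+1) (unitI R) -> X,
    ext_homotopy g h H
    & forall m t, H ((m, sph_base R n), t) = alpha m.

Definition pi_e : set (set (extSph R n.+1 -> X)) :=
  classes based_map based_homotopic.

End pi.
Arguments pi_e [X] n alpha.

Definition pi_e_map (X Y : extSpace) n (f : X -> Y) (alpha : Next -> X) :
    set (extSph R n.+1 -> X) -> set (extSph R n.+1 -> Y) :=
  class_map (based_map (f \o alpha)) (based_homotopic (f \o alpha))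
    (fun g : extSph R n.+1 -> X => f \o g).

Section pi_mul.
Variables (X : extSpace) (m : nat) (alpha : Next -> X).
Implicit Types g h : extSph R m.+2 -> X.

Definition sph_concat g h : extSph R m.+2 -> X := fun p =>
  if 0 <= set_val p.2 0 ord_max then g (p.1, pinch p.2) else h (p.1, pinch p.2).

Definition pi_e_mul (A B : set (extSph R m.+2 -> X)) : set (extSph R m.+2 -> X) :=
  [set k | based_map alpha k /\ exists g h,
     [/\ A g, B h & based_homotopic alpha (sph_concat g h) k]].

End pi_mul.

(* The homotopy groups are [pi_e n alpha] with [n = m.+1]. *)
Definition pi_e_iso (X Y : extSpace) (f : X -> Y) (m : nat) (alpha : Next -> X) :
    Prop :=
  set_bij (pi_e m.+1 alpha) (pi_e m.+1 (f \o alpha)) (pi_e_map f alpha) /\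
  forall A B, pi_e m.+1 alpha A -> pi_e m.+1 alpha B ->
    pi_e_map f alpha (pi_e_mul alpha A B) =
    pi_e_mul (f \o alpha) (pi_e_map f alpha A) (pi_e_map f alpha B).

Definition weak_equivalence (X Y : extSpace) (f : X -> Y) : Prop :=
  [/\ exterior_map f,
      set_bij (htpy_set Next X) (htpy_set Next Y) (@htpy_set_map Next X Y f)
    & forall (m : nat) (alpha : Next -> X), exterior_map alpha ->
        pi_e_iso f m alpha].

Definition has_lifting (A B X Y : extSpace) (i : A -> B) (p : X -> Y) : Prop :=
  forall (u : A -> X) (v : B -> Y), exterior_map u -> exterior_map v ->
    p \o u = v \o i ->
    exists h : B -> X, [/\ exterior_map h, h \o i = u & p \o h = v].

Definition fibration (X Y : extSpace) (p : X -> Y) : Prop :=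
  exterior_map p /\ forall k, has_lifting (@extDisk_extCyl R k) p.

(* The maps with the right lifting property against the generating cofibrations,
   which are the trivial fibrations. *)
Definition trivial_fibration (X Y : extSpace) (p : X -> Y) : Prop :=
  exterior_map p /\ forall k, has_lifting (@extSph_extDisk R k) p.

Definition cofibration (A B : extSpace) (i : A -> B) : Prop :=
  exterior_map i /\
  forall (X Y : extSpace) (p : X -> Y), CGWH X -> CGWH Y ->
    trivial_fibration p -> has_lifting i p.

End homotopy_sets.

Section Estar.
Variable R : realType.

Record Estar := EstarObj {
  Estar_space :> extSpace;
  Estar_CGWH : CGWH Estar_space;
  sec : Rplus R -> Estar_space;
  ret : Estar_space -> Rplus R;
  sec_exterior : exterior_map sec;
  ret_exterior : exterior_map ret;
  ret_sec : ret \o sec = id }.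

Definition Estar_map (X Y : Estar) (f : X -> Y) : Prop :=
  [/\ exterior_map f, f \o @sec X = @sec Y & @ret Y \o f = @ret X].

Lemma exterior_map_id (X : extSpace) : exterior_map (@id X).
Proof. by split=> // x; exact: cvg_id. Qed.

(* The zero object of E_*: [@sec X] and [@ret X] are the only morphisms from it
   to [X] and from [X] to it. *)
Definition Estar_zero : Estar :=
  @EstarObj (Rplus R) (Rplus_CGWH R) id id
    (exterior_map_id _) (exterior_map_id _) erefl.

Lemma Estar_zero_initial (X : Estar) (f : Estar_zero -> X) :
  Estar_map f <-> f = @sec X.
Proof.
split=> [[_ <- _] //|->]; split=> //; first exact: sec_exterior.
exact: ret_sec.
Qed.

Lemma Estar_zero_terminal (X : Estar) (f : X -> Estar_zero) :
  Estar_map f <-> f = @ret X.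
Proof.
split=> [[_ _ <-] //|->]; split=> //; first exact: ret_exterior.
exact: ret_sec.
Qed.

Definition Estar_cofibrant (X : Estar) : Prop :=
  cofibration R (@sec X : Estar_zero -> X).

Definition Estar_fibrant (X : Estar) : Prop :=
  fibration R (@ret X : X -> Estar_zero).

Definition htpic_under (X Y : Estar) (f g : X -> Y) : Prop :=
  exists2 H : extprod X (unitI R) -> Y, ext_homotopy f g H
    & forall (t : unitI R) (s : Rplus R), H (sec X s, t) = sec Y s.

Definition htpy_equiv_under (X Y : Estar) (f : X -> Y) : Prop :=
  [/\ exterior_map f, f \o @sec X = @sec Y
    & exists g : Y -> X,
        [/\ exterior_map g, g \o @sec Y = @sec X,
            htpic_under (g \o f) id & htpic_under (f \o g) id]].

End Estar.

(* Main.v *)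
Require Import Defs.
From HB Require Import structures.
From mathcomp Require Import all_boot all_order all_algebra.
From mathcomp Require Import all_classical all_reals all_analysis.
From mathcomp Require Import ring lra.

Set Implicit Arguments.
Unset Strict Implicit.
Unset Printing Implicit Defensive.

Import Order.TTheory GRing.Theory Num.Theory.
Import numFieldNormedType.Exports.
Local Open Scope classical_set_scope.
Local Open Scope ring_scope.

(** Since [Next] is discrete and disks, spheres and [unitI] are compact, an exterior
    map out of [N x K] is a sequence of maps on [K] that converges uniformly to the
    end of the target ([smap]).  The exterior homotopy groups thus behave like
    ordinary homotopy groups computed simultaneously for all indices of a sequence:
    every continuity question concerns one index at a time, and convergence to the
    end survives any reparametrization, cutting or pasting.

    A homotopy equivalence is a weak equivalence because a map [phi] homotopic to
    the identity is bijective on homotopy classes at every base ray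
    ([pi_injective_htpy_id], [pi_surjective_htpy_id]).  The homotopy moves the base
    ray, but it moves it along a path and then back, and such a trace can be
    contracted ([trace_homotopic]).  Applied to [g \o f] and [f \o g], with
    cancellation, this gives bijectivity of [f]; that the bijections are
    homomorphisms holds for any exterior map ([pi_e_map_mul]).

    Conversely, let [f] be a weak equivalence.  Its bijectivity on homotopy classes
    gives the homotopy extension and lifting property for the pairs formed by a disk
    and its boundary sphere ([pi_bijective_help]): injectivity fills a sphere in
    the source, surjectivity in the next dimension corrects the filling
    ([disk_lift]).  This property says exactly that the endpoint map from the mapping
    path space of [f] to [Y] is a trivial fibration
    ([endpoint_trivial_fibration]).  The mapping path space has to be compactly
    generated and weakly Hausdorff, so it carries the final topology for families of
    paths over compact Hausdorff spaces.  As [Y] is cofibrant, the identity of [Y]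
    lifts through the endpoint map relative to the half-line; the lift consists of a
    map [g] under the half-line and a homotopy from [f \o g] to the identity under the
    half-line ([help_right_inverse]).  By change of base ray [g] is again bijective on
    homotopy classes, so the same argument for the cofibrant [X] gives a right
    homotopy inverse [g'] of [g]; then [f] is homotopic to [g'], which makes [g] a
    two-sided homotopy inverse of [f]. *)

(** * Continuity of explicit maps *)

Section continuity_basics.

Lemma nbhsS (T : topologicalType) (x : T) (A B : set T) :
  nbhs x A -> A `<=` B -> nbhs x B.
Proof. by move=> nA AB; exact: filterS AB nA. Qed.

Lemma ct_comp (S T U : topologicalType) (g : T -> U) (f : S -> T) :
  continuous g -> continuous f -> continuous (fun x => g (f x)).
Proof. by move=> cg cf x; apply: continuous_comp; [exact: cf|exact: cg]. Qed.

Lemma ct_id (T : topologicalType) : continuous (fun x : T => x).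
Proof. by move=> x; exact: cvg_id. Qed.

Lemma ct_cst (S T : topologicalType) (a : T) : continuous (fun _ : S => a).
Proof. by move=> x; exact: cvg_cst. Qed.

Lemma ct_pair (S T U : topologicalType) (f : S -> T) (g : S -> U) :
  continuous f -> continuous g -> continuous (fun x => (f x, g x)).
Proof. by move=> cf cg x; apply: cvg_pair; [exact: cf|exact: cg]. Qed.

Lemma ct_fst (S T : topologicalType) : continuous (@fst S T).
Proof. by move=> x; exact: cvg_fst. Qed.

Lemma ct_snd (S T : topologicalType) : continuous (@snd S T).
Proof. by move=> x; exact: cvg_snd. Qed.

Lemma ct_set_val (T : topologicalType) (A : set T) :
  continuous (set_val : set_type A -> T).
Proof. exact: (@initial_continuous _ _ set_val). Qed.

Lemma ct_set_type (S T : topologicalType) (A : set T) (f : S -> set_type A) :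
  continuous (fun x => set_val (f x)) -> continuous f.
Proof.
move=> cf; apply/continuousP => _ [B oB <-].
by move/continuousP : cf => /(_ B oB).
Qed.

Section ordered.
Variable R : realType.

Lemma ct_row (S : topologicalType) k (f : S -> 'rV[R]_k) :
  (forall i, continuous (fun x => f x 0 i)) -> continuous f.
Proof.
move=> cf; suff H (x : S) A : nbhs (f x) A -> nbhs x (f @^-1` A) by move=> x A /H.
move=> [P HP PA].
have H : forall i : 'I_k, nbhs x (fun y => P 0 i (f y 0 i)).
  by move=> i; apply: (cf i x); exact: HP.
have {}H := filter_forall (nbhs_filter x) H.
have Hs : (fun y => forall i : 'I_k, P 0 i (f y 0 i)) `<=` f @^-1` A.
  by move=> y Hy; apply: PA => i j; rewrite (ord1 i); exact: Hy.
exact: filterS Hs H.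
Qed.

Lemma ct_coord (S : topologicalType) k (f : S -> 'rV[R]_k) i :
  continuous f -> continuous (fun x => f x 0 i).
Proof. by move=> cf; apply: (ct_comp (@coord_continuous _ _ _ 0 i) cf). Qed.

Lemma ctD (S : topologicalType) (V : normedModType R) (f g : S -> V) :
  continuous f -> continuous g -> continuous (fun x => f x + g x).
Proof. by move=> cf cg x; apply: cvgD; [exact: cf|exact: cg]. Qed.

Lemma ctN (S : topologicalType) (V : normedModType R) (f : S -> V) :
  continuous f -> continuous (fun x => - f x).
Proof. by move=> cf x; apply: cvgN; exact: cf. Qed.

Lemma ctM (S : topologicalType) (f g : S -> R) :
  continuous f -> continuous g -> continuous (fun x => f x * g x).
Proof. by move=> cf cg x; apply: cvgM; [exact: cf|exact: cg]. Qed.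

Lemma ctMn (S : topologicalType) (f : S -> R) n :
  continuous f -> continuous (fun x => f x *+ n).
Proof. by move=> cf; apply: (ct_comp (@natmul_continuous _ _ n) cf). Qed.

Lemma ctX (S : topologicalType) (f : S -> R) n :
  continuous f -> continuous (fun x => f x ^+ n).
Proof.
move=> cf; elim: n => [|n IH].
  rewrite (_ : (fun x => _) = fun=> 1); first exact: ct_cst.
  by apply/funext => x; rewrite expr0.
rewrite (_ : (fun x => _) = fun x => f x * f x ^+ n); first exact: ctM.
by apply/funext => x; rewrite exprS.
Qed.

Lemma ctZ (S : topologicalType) (V : normedModType R) (f : S -> R) (g : S -> V) :
  continuous f -> continuous g -> continuous (fun x => f x *: g x).
Proof. by move=> cf cg x; apply: cvgZ; [exact: cf|exact: cg]. Qed.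

Lemma ctV (S : topologicalType) (f : S -> R) :
  (forall x, f x != 0) -> continuous f -> continuous (fun x => (f x)^-1).
Proof. by move=> f0 cf x; apply: cvgV; [exact: f0|exact: cf]. Qed.

Lemma ct_min (S : topologicalType) (f g : S -> R) :
  continuous f -> continuous g -> continuous (fun x => Num.min (f x) (g x)).
Proof.
by move=> cf cg x; apply: (@continuous_min R S f g x); [exact: cf|exact: cg].
Qed.

Lemma ct_max (S : topologicalType) (f g : S -> R) :
  continuous f -> continuous g -> continuous (fun x => Num.max (f x) (g x)).
Proof.
by move=> cf cg x; apply: (@continuous_max R S f g x); [exact: cf|exact: cg].
Qed.

Lemma ct_sqrt (S : topologicalType) (f : S -> R) :
  continuous f -> continuous (fun x => Num.sqrt (f x)).
Proof. exact: (ct_comp (@sqrt_continuous R)). Qed.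

Lemma ct_norm (S : topologicalType) (f : S -> R) :
  continuous f -> continuous (fun x => `|f x|).
Proof. exact: (ct_comp (@norm_continuous _ _)). Qed.

Lemma ct_sum (S : topologicalType) k (f : 'I_k -> S -> R) :
  (forall i, continuous (f i)) -> continuous (fun x => \sum_(i < k) f i x).
Proof.
move=> cf x; apply: (@cvg_big R 'I_k) => [|i _]; last exact: cf.
exact: add_continuous.
Qed.

Lemma ct_sqnorm (S : topologicalType) k (f : S -> 'rV[R]_k) :
  continuous f -> continuous (fun x => sqnorm (f x)).
Proof. by move=> cf; apply: ct_sum => i; apply: ctX; exact: ct_coord. Qed.

(** Pasting along a level set of a real function.  Both maps are total, which the
    retractions [clamp] and [to_disk] below allow for every formula in use. *)
Lemma ct_if (S T : topologicalType) (a : S -> R) (c : R) (f g : S -> T) :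
  continuous a -> continuous f -> continuous g ->
  (forall x, a x = c -> f x = g x) ->
  continuous (fun x => if a x <= c then f x else g x).
Proof.
move=> ca cf cg fg.
suff H (x : S) A : nbhs (if a x <= c then f x else g x) A ->
    nbhs x (fun y => A (if a y <= c then f y else g y)) by move=> x A /H.
have [axc|axc|axc] := ltgtP (a x) c => nA.
- have nx : nbhs x (a @^-1` [set r | r < c]).
    by apply: (ca x); apply: open_nbhs_nbhs; split=> //; exact: open_lt.
  have nf : nbhs x (f @^-1` A) := cf x _ nA.
  by apply: filterS (filterI nx nf) => y [/= /ltW -> Af].
- have nx : nbhs x (a @^-1` [set r | c < r]).
    by apply: (ca x); apply: open_nbhs_nbhs; split=> //; exact: open_gt.
  have ng : nbhs x (g @^-1` A) := cg x _ nA.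
  by apply: filterS (filterI nx ng) => y [/= + Ag]; rewrite ltNge => /negbTE ->.
- have nf : nbhs x (f @^-1` A) := cf x _ nA.
  have ng : nbhs x (g @^-1` A) by apply: (cg x); rewrite -fg.
  by apply: filterS (filterI nf ng) => y [/= Af Ag]; case: ifP.
Qed.

End ordered.

(** Where [sigma] jumps, [W] does not see its compact argument, and the tube lemma
    gives continuity.  In this way maps on a cone, or on a square with a collapsed
    edge, are built without forming a quotient space. *)
Lemma ct_tube (L A C T : topologicalType) (W : A * C -> T) (theta : L -> A)
    (sigma : L -> C) :
  compact [set: C] -> continuous W -> continuous theta ->
  (forall l, {for l, continuous sigma} \/
             forall c, W (theta l, c) = W (theta l, sigma l)) ->
  continuous (fun l => W (theta l, sigma l)).
Proof.
move=> cC cW ct H l; have [cs|cst] := H l.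
  apply: (@continuous_comp _ _ _ (fun l => (theta l, sigma l)) W).
    by apply: cvg_pair; [exact: ct|exact: cs].
  exact: cW.
move=> O nO.
have /compact_near_coveringP/(_ A (nbhs (theta l))
  (fun a c => O (W (a, c))) (nbhs_filter _)) near_cover := cC.
have nU : nbhs (theta l) (fun a => forall c, O (W (a, c))).
  have : nbhs (theta l) (fun a => [set: C] `<=` (fun c => O (W (a, c)))).
    apply: near_cover => c _; have : nbhs (W (theta l, c)) O by rewrite cst.
    move=> /cW [[U V] /= [nU nV] UV]; exists (V, U) => //.
    by move=> [c' a] [/= Vc Ua]; apply: (UV (a, c')).
  by move=> H2; apply: (nbhsS H2) => a Ha c; exact: Ha.
by apply: (nbhsS (ct l _ nU)) => l'; exact.
Qed.

End continuity_basics.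

(** * Intervals, disks and spheres *)

Lemma compact_subtype (T : topologicalType) (A : set T) :
  compact A -> compact [set: set_type A].
Proof.
move=> cA; have [a|H] := pselect (exists a : set_type A, True).
  by case: a => a _; exact: compact_set_type a cA.
rewrite (_ : [set: set_type A] = set0); first exact: compact0.
by apply/seteqP; split=> // x _; case: H; exists x.
Qed.

Section geometry.
Variable R : realType.

Lemma unitI0E : set_val (unitI0 R) = 0. Proof. by []. Qed.

Lemma unitI1E : set_val (unitI1 R) = 1. Proof. by []. Qed.

Lemma unitI_ge0 (t : unitI R) : 0 <= set_val t.
Proof. by have := set_valP t; rewrite /= in_itv /= => /andP[]. Qed.

Lemma unitI_le1 (t : unitI R) : set_val t <= 1.
Proof. by have := set_valP t; rewrite /= in_itv /= => /andP[]. Qed.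

Lemma clamp_subproof (r : R) :
  Num.max 0 (Num.min 1 r) \in (`[0, 1]%classic : set R).
Proof.
by rewrite inE /= in_itv /= le_max lexx ge_max ler01 ge_min lexx.
Qed.
Definition clamp (r : R) : unitI R :=
  exist (fun x => x \in (`[0, 1]%classic : set R)) _ (clamp_subproof r).

Lemma set_val_clamp (r : R) : 0 <= r <= 1 -> set_val (clamp r) = r.
Proof. by move=> /andP[r0 r1]; rewrite /set_val /= min_r // max_r. Qed.

Lemma clampK (t : unitI R) : clamp (set_val t) = t.
Proof. by apply: val_inj; apply: set_val_clamp; rewrite unitI_ge0 unitI_le1. Qed.

Lemma clamp_le0 (r : R) : r <= 0 -> clamp r = unitI0 R.
Proof. by move=> r0; apply: val_inj => /=; rewrite max_l // ge_min r0 orbT. Qed.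

Lemma clamp_ge1 (r : R) : 1 <= r -> clamp r = unitI1 R.
Proof. by move=> r0; apply: val_inj => /=; rewrite min_l // max_r. Qed.

Lemma ct_clamp (S : topologicalType) (f : S -> R) :
  continuous f -> continuous (fun x => clamp (f x)).
Proof.
by move=> cf; apply: ct_set_type; apply: ct_max; [|apply: ct_min => //]; exact: ct_cst.
Qed.

Lemma compact_unitI : compact [set: unitI R].
Proof. by apply: compact_subtype; exact: segment_compact. Qed.

Lemma hausdorff_unitI : hausdorff_space (unitI R).
Proof. by apply: set_val_hausdorff; exact: Rhausdorff. Qed.

Section vectors.
Variable k : nat.
Implicit Types x y : 'rV[R]_k.

Definition dot x y : R := \sum_i x 0 i * y 0 i.

Lemma sqnorm_ge0 x : 0 <= sqnorm x.
Proof. by apply: sumr_ge0 => i _; exact: sqr_ge0. Qed.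

Lemma sqnormZ (a : R) x : sqnorm (a *: x) = a ^+ 2 * sqnorm x.
Proof.
by rewrite /sqnorm mulr_sumr; apply: eq_bigr => i _; rewrite mxE exprMn.
Qed.

Lemma sqnormD x y : sqnorm (x + y) = sqnorm x + dot x y *+ 2 + sqnorm y.
Proof.
rewrite /sqnorm /dot -sumrMnl -!big_split /=; apply: eq_bigr => i _.
by rewrite mxE sqrrD.
Qed.

Lemma dotZ (a b : R) x y : dot (a *: x) (b *: y) = a * b * dot x y.
Proof.
by rewrite /dot mulr_sumr; apply: eq_bigr => i _; rewrite !mxE; ring.
Qed.

Lemma sqnorm0 : sqnorm (0 : 'rV[R]_k) = 0.
Proof. by rewrite /sqnorm big1 // => i _; rewrite mxE expr0n. Qed.

Lemma sqnorm_eq0 x : sqnorm x = 0 -> x = 0.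
Proof.
move=> x0; apply/rowP => i; rewrite mxE; apply/eqP; rewrite -sqrf_eq0.
move/eqP : x0; rewrite psumr_eq0; last by move=> j _; exact: sqr_ge0.
by move/allP/(_ i (mem_index_enum _)).
Qed.

Lemma coord_le_sqnorm x i : x 0 i ^+ 2 <= sqnorm x.
Proof.
rewrite /sqnorm (bigD1 i) //= lerDl.
by apply: sumr_ge0 => j _; exact: sqr_ge0.
Qed.

Definition norm2 x : R := Num.sqrt (sqnorm x).

Lemma norm2_ge0 x : 0 <= norm2 x. Proof. exact: sqrtr_ge0. Qed.

Lemma sqr_norm2 x : norm2 x ^+ 2 = sqnorm x.
Proof. by rewrite sqr_sqrtr // sqnorm_ge0. Qed.

Lemma norm2_le1 x : (norm2 x <= 1) = (sqnorm x <= 1).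
Proof. by rewrite -sqr_norm2 expr_le1 // norm2_ge0. Qed.

Lemma norm2_eq1 x : sqnorm x = 1 -> norm2 x = 1.
Proof. by move=> h; rewrite /norm2 h sqrtr1. Qed.

Lemma norm2Z (a : R) x : 0 <= a -> norm2 (a *: x) = a * norm2 x.
Proof.
move=> a0; rewrite /norm2 sqnormZ sqrtrM ?sqr_ge0 //.
by rewrite sqrtr_sqr ger0_norm.
Qed.

Lemma ct_norm2 (S : topologicalType) (f : S -> 'rV[R]_k) :
  continuous f -> continuous (fun z => norm2 (f z)).
Proof. by move=> cf; apply: ct_sqrt; exact: ct_sqnorm. Qed.

Lemma to_disk_subproof x : (Num.max 1 (norm2 x))^-1 *: x \in @disk_set R k.
Proof.
rewrite inE /disk_set /= sqnormZ -sqr_norm2 -exprMn expr_le1 //; last first.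
  by rewrite mulr_ge0 ?norm2_ge0 // invr_ge0 le_max ler01.
rewrite mulrC ler_pdivrMr ?mul1r; first by rewrite le_max lexx orbT.
by rewrite lt_max ltr01.
Qed.
Definition to_disk x : disk R k :=
  exist (fun y => y \in @disk_set R k) _ (to_disk_subproof x).

Lemma set_val_to_disk x : sqnorm x <= 1 -> set_val (to_disk x) = x.
Proof.
by rewrite -norm2_le1 => x1; rewrite /set_val /= max_l // invr1 scale1r.
Qed.

Lemma disk_le1 (x : disk R k) : sqnorm (set_val x) <= 1.
Proof. exact: (set_valP x). Qed.

Lemma sph_eq1 (x : sph R k) : sqnorm (set_val x) = 1.
Proof. exact: (set_valP x). Qed.

Lemma sph_le1 (x : sph R k) : sqnorm (set_val x) <= 1.
Proof. by rewrite sph_eq1. Qed.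

Lemma to_diskK (x : disk R k) : to_disk (set_val x) = x.
Proof. by apply: val_inj; apply: set_val_to_disk; exact: disk_le1. Qed.

Lemma to_disk_sph (b : sph R k) : to_disk (set_val b) = sph_disk b.
Proof. by apply: val_inj; apply: set_val_to_disk; exact: sph_le1. Qed.

Lemma ct_to_disk (S : topologicalType) (f : S -> 'rV[R]_k) :
  continuous f -> continuous (fun z => to_disk (f z)).
Proof.
move=> cf; apply: ct_set_type; apply: ctZ => //; apply: ctV => [x|].
  by rewrite gt_eqF // lt_max ltr01.
by apply: ct_max; [exact: ct_cst|exact: ct_norm2].
Qed.

Lemma ct_sph_disk : continuous (@sph_disk R k).
Proof. by apply: ct_set_type; exact: ct_set_val. Qed.

Lemma compact_rV (A : set 'rV[R]_k) :
  closed A -> (forall x, A x -> sqnorm x <= 1) -> compact A.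
Proof.
move=> cA A1; apply: bounded_closed_compact => //.
exists 1; split=> [|M M1 x Ax]; first exact: num_real.
apply: le_trans (ltW M1); rewrite [leLHS]/Num.norm /= mx_normrE.
apply/bigmax_leP; split=> // -[i j] _ /=.
rewrite (ord1 i) -(@ler_pXn2r _ 2) ?nnegrE // expr1n -normrX ger0_norm ?sqr_ge0 //.
exact: le_trans (coord_le_sqnorm _ _) (A1 _ Ax).
Qed.

Lemma compact_disk : compact [set: disk R k].
Proof.
apply: compact_subtype; apply: compact_rV => //.
rewrite (_ : @disk_set R k = @sqnorm R k @^-1` [set r | r <= 1]) //.
apply: closed_comp; last exact: closed_le.
by move=> x _; apply: ct_sqnorm; exact: ct_id.
Qed.

Lemma compact_sph : compact [set: sph R k].
Proof.
apply: compact_subtype; apply: compact_rV => [|x -> //].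
rewrite (_ : @sph_set R k = @sqnorm R k @^-1` [set r | r = 1]) //.
apply: closed_comp; last exact: closed_eq.
by move=> x _; apply: ct_sqnorm; exact: ct_id.
Qed.

Lemma hausdorff_rV : hausdorff_space 'rV[R]_k.
Proof. exact: norm_hausdorff. Qed.

Lemma hausdorff_disk : hausdorff_space (disk R k).
Proof. by apply: set_val_hausdorff; exact: hausdorff_rV. Qed.

End vectors.

Section to_sphere.
Variable k : nat.
Implicit Types x y : 'rV[R]_k.+1.

Lemma to_sph_subproof x :
  (if sqnorm x == 0 then delta_mx 0 0 else (norm2 x)^-1 *: x) \in @sph_set R k.+1.
Proof.
case: eqP => [_|/eqP x0]; first exact: (sph_base_subproof R k).
rewrite inE /sph_set /= sqnormZ exprVn sqr_norm2 mulVf //.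
Qed.
Definition to_sph x : sph R k.+1 :=
  exist (fun y => y \in @sph_set R k.+1) _ (to_sph_subproof x).

Lemma set_val_to_sph x : sqnorm x != 0 -> set_val (to_sph x) = (norm2 x)^-1 *: x.
Proof. by move=> x0; rewrite /set_val /= (negbTE x0). Qed.

Lemma to_sphZ (a : R) (b : sph R k.+1) : 0 < a -> to_sph (a *: set_val b) = b.
Proof.
move=> a0; apply: val_inj; change (set_val (to_sph (a *: set_val b)) = set_val b).
rewrite set_val_to_sph; last by rewrite sqnormZ sph_eq1 mulr1 sqrf_eq0 gt_eqF.
rewrite norm2Z ?ltW // (norm2_eq1 (sph_eq1 b)) mulr1 scalerA mulVf ?scale1r //.
by rewrite gt_eqF.
Qed.

Lemma to_sphK (b : sph R k.+1) : to_sph (set_val b) = b.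
Proof. by rewrite -[X in to_sph X]scale1r to_sphZ. Qed.

Lemma norm2_to_sph x : norm2 x *: set_val (to_sph x) = x.
Proof.
have [x0|x0] := eqVneq (sqnorm x) 0.
  by rewrite (sqnorm_eq0 x0) /norm2 sqnorm0 sqrtr0 scale0r.
rewrite set_val_to_sph // scalerA mulfV ?scale1r //.
by rewrite -sqrf_eq0 sqr_norm2.
Qed.

Lemma ct_to_sph x : sqnorm x != 0 -> {for x, continuous to_sph}.
Proof.
move=> x0 A [_ /= [[B oB <-] Bx BA]].
pose U : set 'rV[R]_k.+1 := sqnorm (k := k.+1) @^-1` [set r | r != 0].
have nU : nbhs x U.
  apply: (@ct_sqnorm R _ _ id (@ct_id _) x).
  by apply: open_nbhs_nbhs; split=> //; exact: open_neq.
have nV : nbhs x ((fun y => (norm2 y)^-1 *: y) @^-1` B).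
  have : {for x, continuous (fun y => (norm2 y)^-1 *: y)}.
    apply: continuousZ; last exact: cvg_id.
    apply: continuousV; first by rewrite -sqrf_eq0 sqr_norm2.
    exact: (@ct_norm2 _ _ id (@ct_id _) x).
  apply; apply: open_nbhs_nbhs; split=> //.
  by rewrite -set_val_to_sph.
apply: (nbhsS (filterI nU nV)) => y [/= y0 By]; apply: BA.
by change (B (set_val (to_sph y))); rewrite set_val_to_sph.
Qed.

Lemma ct_to_sph_comp (S : topologicalType) (f : S -> 'rV[R]_k.+1) :
  continuous f -> (forall z, sqnorm (f z) != 0) ->
  continuous (fun z => to_sph (f z)).
Proof.
move=> cf f0 x; apply: continuous_comp; first exact: cf.
exact: ct_to_sph.
Qed.

End to_sphere.

End geometry.

Ltac ct_atom := lazymatch goal with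
  | |- continuous fst => exact: ct_fst
  | |- continuous snd => exact: ct_snd
  | |- continuous set_val => exact: ct_set_val
  | |- continuous (@sph_disk _ _) => exact: ct_sph_disk
  | |- _ => first
    [ assumption
    | match goal with H : forall _, continuous _ |- _ => exact: H end ]
  end.

Ltac ct := lazymatch goal with
  | |- continuous (fun x => x) => exact (@ct_id _)
  | |- continuous (fun x => (@?f x, @?g x)) => refine (ct_pair (f := f) (g := g) _ _); ct
  | |- continuous (fun x => @?f x + @?g x) => refine (ctD (f := f) (g := g) _ _); ct
  | |- continuous (fun x => - @?f x) => refine (ctN (f := f) _); ct
  | |- continuous (fun x => @?f x * @?g x) => refine (ctM (f := f) (g := g) _ _); ct
  | |- continuous (fun x => @?f x *: @?g x) => refine (ctZ (f := f) (g := g) _ _); ct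
  | |- continuous (fun x => @?f x ^+ _) => refine (ctX (f := f) _); ct
  | |- continuous (fun x => @?f x *+ _) => refine (ctMn (f := f) _); ct
  | |- continuous (fun x => Num.min (@?f x) (@?g x)) =>
      refine (ct_min (f := f) (g := g) _ _); ct
  | |- continuous (fun x => Num.max (@?f x) (@?g x)) =>
      refine (ct_max (f := f) (g := g) _ _); ct
  | |- continuous (fun x => Num.sqrt (@?f x)) => refine (ct_sqrt (f := f) _); ct
  | |- continuous (fun x => `|@?f x|) => refine (ct_norm (f := f) _); ct
  | |- continuous (fun x => norm2 (@?f x)) => refine (ct_norm2 (f := f) _); ct
  | |- continuous (fun x => sqnorm (@?f x)) => refine (ct_sqnorm (f := f) _); ct
  | |- continuous (fun x => clamp (@?f x)) => refine (ct_clamp (f := f) _); ct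
  | |- continuous (fun x => to_disk (@?f x)) => refine (ct_to_disk (f := f) _); ct
  | |- continuous (fun x => @fun_of_matrix _ _ _ (@?f x) _ _) =>
      refine (ct_coord (f := f) _); ct
  | |- continuous (fun x => ?h (@?f x)) =>
      lazymatch f with
      | (fun x => x) => first [ change (continuous h); ct_atom | exact (@ct_cst _ _ _) ]
      | _ => first
        [ refine (ct_comp (g := h) (f := f) _ _); [ct_atom | ct]
        | exact (@ct_cst _ _ _) ]
      end
  | |- continuous ?f => first [ ct_atom | exact (@ct_cst _ _ _) ]
  end.

(** * Exterior maps out of products with a compact space *)

Section exterior_products.

Lemma exterior_comp (X Y Z : extSpace) (f : X -> Y) (g : Y -> Z) :
  exterior_map f -> exterior_map g -> exterior_map (g \o f).
Proof.
move=> [cf ef] [cg eg]; split; first exact: (ct_comp cg cf).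
by move=> A /eg /ef.
Qed.

(** The exterior sets [F] that the definition gives for the various points of [K]
    can be intersected down to a single one, since finitely many of them suffice. *)
Lemma extprod_setsP (A : extSpace) (K : topologicalType) (W : set (A * K)) :
  compact [set: K] ->
  extprod_sets W <->
  open W /\ exists2 F : set A, exterior F & forall a k, F a -> W (a, k).
Proof.
move=> cK; split=> [[oW HW]|[oW [F eF FW]]]; last first.
  split=> // y; exists F, setT; split=> //; first exact: openT.
  by move=> [a k] [/= Fa _]; exact: FW.
split=> //.
pose G : set (set A) := filter_from (@exterior A) id.
have fG : Filter G.
  apply: filter_from_filter; first exact: exterior_nonempty.
  by move=> i j ei ej; exists (i `&` j) => //; exact: exteriorI.
have /compact_near_coveringP/(_ A G (fun a k => W (a, k)) fG) near_cover := cK.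
case: near_cover => [k _|F eF FW]; last by exists F => // a k Fa; exact: FW.
have [F [U [eF oU Uk FU]]] := HW k.
exists (U, F); first by split; [exact: open_nbhs_nbhs|exists F].
by move=> [k' a] [/= Uk' Fa]; apply: (FU (a, k')).
Qed.

Lemma exterior_mapP (A X : extSpace) (K : topologicalType)
    (g : extprod A K -> X) :
  compact [set: K] ->
  exterior_map g <-> continuous g /\ forall E, exterior E ->
    exists2 F : set A, exterior F & forall a k, F a -> E (g (a, k)).
Proof.
move=> cK; split=> [[cg eg]|[cg eg]]; split=> // E eE.
  by have /extprod_setsP-/(_ cK) [_] := eg _ eE.
apply/extprod_setsP => //; split; last exact: eg.
by move/continuousP : cg; apply; exact: exterior_open.
Qed.

Lemma Next_exteriorP (F : set Next) :
  exterior F <-> exists m0 : nat, forall m, (m0 <= m)%N -> F m.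
Proof.
split=> [[K [cK kK] <-]|[m0 H]].
  have /compact_near_coveringP := kK.
  move=> /(_ nat \oo (fun i m => m <= i)%N _) [m _|m0 _ H].
    exists ([set m], [set i | (m <= i)%N]).
      by split; [exact: discrete_set1|exists m].
    by move=> [m' i] [/= ->].
  exists m0.+1 => m mm0 Km; have /= := H m0 (leqnn _) m Km.
  by rewrite leqNgt mm0.
exists (~` F); last by rewrite setCK.
split; first by apply: open_closedC; exact: discrete_open.
apply: finite_compact; apply: (@sub_finite_set _ _ `I_m0); last exact: finite_II.
by move=> m /= nF; rewrite ltnNge; apply/negP => mm0; exact/nF/H.
Qed.

(** An exterior map out of the product of [Next] with a compact [K], as a sequence
    of maps on [K]. *)
Definition smap (K : topologicalType) (X : extSpace) (g : nat -> K -> X) : Prop :=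
  (forall m, continuous (g m)) /\ forall E, exterior E ->
  exists m0 : nat, forall m, (m0 <= m)%N -> forall k, E (g m k).

Lemma ct_Next (K X : topologicalType) (g : Next * K -> X) :
  continuous g <-> forall m, continuous (fun k => g (m, k)).
Proof.
split=> [cg m|cg [m k] A nA].
  by apply: (ct_comp cg); apply: ct_pair; [exact: ct_cst|exact: ct_id].
exists ([set m], (fun k => A (g (m, k)))).
  by split; [exact: discrete_set1|exact: (cg m k)].
by move=> [m' k'] [/= ->].
Qed.

Lemma smapP (K : topologicalType) (X : extSpace) (g : extprod Next K -> X) :
  compact [set: K] -> exterior_map g <-> smap (fun m k => g (m, k)).
Proof.
move=> cK; split.
  move=> /exterior_mapP-/(_ cK) [cg eg]; split; first exact/ct_Next.
  move=> E /eg [F /Next_exteriorP [m0 H] FE]; exists m0 => m mm0 k.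
  by apply: FE; exact: H.
move=> [cg eg]; apply/exterior_mapP => //; split; first exact/ct_Next.
move=> E /eg [m0 H]; exists [set m | (m0 <= m)%N].
  by apply/Next_exteriorP; exists m0.
by move=> a k am; exact: (H a am k).
Qed.

Lemma Next_mapP (X : extSpace) (alpha : Next -> X) :
  exterior_map alpha <-> forall E, exterior E ->
  exists m0 : nat, forall m, (m0 <= m)%N -> E (alpha m).
Proof.
split=> [[ca ea] E /ea /Next_exteriorP //|ea].
split=> [m A nA|E /ea [m0 H]]; last by apply/Next_exteriorP; exists m0.
by apply: (nbhsS (discrete_set1 m)) => _ ->; exact: (nbhs_singleton nA).
Qed.

Section with_interval.
Variable R : realType.
Local Notation I := (unitI R).

Lemma smap_htpyP (K : topologicalType) (X : extSpace)
    (H : extprod (extprod Next K) I -> X) : compact [set: K] ->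
  exterior_map H <-> smap (fun m (p : K * I) => H ((m, p.1), p.2)).
Proof.
move=> cK; have cI := @compact_unitI R.
have cKI : compact [set: K * I].
  by rewrite -setXTT; exact: compact_setX.
pose a (p : extprod (extprod Next K) I) : Next * (K * I) := (p.1.1, (p.1.2, p.2)).
pose b (p : Next * (K * I)) : extprod (extprod Next K) I := ((p.1, p.2.1), p.2.2).
have ca : continuous a by rewrite /a; ct.
have cb : continuous b by rewrite /b; ct.
split.
  move=> /exterior_mapP-/(_ cI) [cH eH]; split.
    by apply/(@ct_Next _ _ (fun p => H (b p))); exact: (ct_comp cH cb).
  move=> E /eH [F eF FE].
  have [_ [G /Next_exteriorP [m0 Gm0] GF]] := (extprod_setsP F cK).1 eF.
  by exists m0 => m mm0 [k t]; apply: FE; apply: GF; exact: Gm0.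
move=> [cH eH]; apply/exterior_mapP => //; split.
  have : continuous (fun p : Next * (K * I) => H (b p)) by exact/ct_Next.
  move=> cHb; have := ct_comp cHb ca.
  by rewrite (_ : (fun x => H (b (a x))) = H) //; apply/funext => -[[]].
move=> E /eH [m0 H0]; exists [set p : Next * K | (m0 <= p.1)%N]; last first.
  by move=> [m k] t /= mm0; exact: (H0 m mm0 (k, t)).
apply/extprod_setsP => //; split.
  rewrite (_ : [set p | _] = fst @^-1` [set m : Next | (m0 <= m)%N]) //.
  by apply: open_comp; [move=> ? _; exact: ct_fst|exact: discrete_open].
exists [set m | (m0 <= m)%N] => //.
by apply/Next_exteriorP; exists m0.
Qed.

(** * Reversing and concatenating exterior homotopies *)

Section homotopies.
Variables A X : extSpace.
Implicit Types H : extprod A I -> X.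

Definition hrev H : extprod A I -> X := fun p => H (p.1, clamp (1 - set_val p.2)).

Definition hcat H H' : extprod A I -> X := fun p =>
  if set_val p.2 <= 2^-1 then H (p.1, clamp (2 * set_val p.2))
  else H' (p.1, clamp (2 * set_val p.2 - 1)).

Lemma hcst_homotopy (f : A -> X) : exterior_map f ->
  ext_homotopy f f (fun p : extprod A I => f p.1).
Proof.
move=> [cf ef]; split=> //; apply/exterior_mapP; first exact: compact_unitI.
split; first by ct.
by move=> E /ef eE; exists (f @^-1` E).
Qed.

Lemma hrev_homotopy (f g : A -> X) H :
  ext_homotopy f g H -> ext_homotopy g f (hrev H).
Proof.
have cI := @compact_unitI R.
move=> [/exterior_mapP-/(_ cI) [cH eH] H0 H1]; split=> [|x|x].
- apply/exterior_mapP => //; split.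
    by rewrite /hrev; ct.
  by move=> E /eH [F eF FE]; exists F => // a k; exact: FE.
- by rewrite /hrev /= clamp_ge1 // subr0.
- by rewrite /hrev /= clamp_le0 // subrr.
Qed.

Lemma hcat_homotopy (f g h : A -> X) H H' :
  ext_homotopy f g H -> ext_homotopy g h H' -> ext_homotopy f h (hcat H H').
Proof.
have cI := @compact_unitI R.
move=> [/exterior_mapP-/(_ cI) [cH eH] H0 H1].
move=> [/exterior_mapP-/(_ cI) [cH' eH'] H'0 H'1]; split=> [|x|x].
- apply/exterior_mapP => //; split.
    apply: (@ct_if R _ _ (fun p : A * I => set_val p.2)); [ct|ct|ct|].
    move=> [a t] /= ->; rewrite mulfV // subrr clamp_ge1 // clamp_le0 //.
      by rewrite H1 H'0.
  move=> E eE; have [F eF FE] := eH _ eE; have [F' eF' FE'] := eH' _ eE.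
  exists (F `&` F'); first exact: exteriorI.
  by move=> a k [Fa Fa']; rewrite /hcat; case: ifP => _; [exact: FE|exact: FE'].
- by rewrite /hcat /= invr_ge0 ler0n mulr0 clamp_le0.
- have -> : hcat H H' (x, unitI1 R) = H' (x, clamp (2 * 1 - 1)).
    by rewrite /hcat /= unitI1E ifF //; apply/negbTE; rewrite -ltNge; lra.
  by rewrite clamp_ge1 ?H'1 //; lra.
Qed.

Lemma ext_homotopic_refl (f : A -> X) : exterior_map f -> ext_homotopic R f f.
Proof. by move=> ef; eexists; exact: hcst_homotopy ef. Qed.

Lemma ext_homotopic_sym (f g : A -> X) :
  ext_homotopic R f g -> ext_homotopic R g f.
Proof. by move=> [H /hrev_homotopy]; exists (hrev H). Qed.

Lemma ext_homotopic_trans (f g h : A -> X) :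
  ext_homotopic R f g -> ext_homotopic R g h -> ext_homotopic R f h.
Proof. by move=> [H hH] [H' hH']; exists (hcat H H'); exact: hcat_homotopy hH hH'. Qed.

End homotopies.

Lemma comp_homotopy (A X Y : extSpace) (f g : A -> X) (phi : X -> Y)
    (H : extprod A I -> X) : exterior_map phi ->
  ext_homotopy f g H -> ext_homotopy (phi \o f) (phi \o g) (phi \o H).
Proof.
move=> ephi [eH H0 H1]; split=> [|x|x] /=; [|by rewrite H0|by rewrite H1].
exact: exterior_comp eH ephi.
Qed.

Lemma precomp_homotopy (A X Y : extSpace) (f g : X -> Y) (u : A -> X)
    (H : extprod X I -> Y) : exterior_map u ->
  ext_homotopy f g H ->
  ext_homotopy (f \o u) (g \o u) (fun p : extprod A I => H (u p.1, p.2)).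
Proof.
move=> [cu eu] [/exterior_mapP-/(_ (@compact_unitI R)) [cH eH] H0 H1].
split=> [|x|x]; [|exact: H0|exact: H1].
apply/exterior_mapP; first exact: compact_unitI; split.
  by ct.
by move=> E /eH [F /eu eF FE]; exists (u @^-1` F) => // a k; exact: FE.
Qed.

End with_interval.

End exterior_products.

(** * Bijectivity on sets of classes *)

Section classes_bijection.
Variables (T T' : Type) (D : set T) (D' : set T').
Variables (r : T -> T -> Prop) (r' : T' -> T' -> Prop) (phi : T -> T').
Hypothesis r_refl : forall x, D x -> r x x.
Hypothesis r_sym : forall x y, r x y -> r y x.
Hypothesis r_trans : forall x y z, r x y -> r y z -> r x z.
Hypothesis r'_refl : forall x, D' x -> r' x x.
Hypothesis r'_sym : forall x y, r' x y -> r' y x.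
Hypothesis r'_trans : forall x y z, r' x y -> r' y z -> r' x z.
Hypothesis phiD : forall x, D x -> D' (phi x).
Hypothesis phi_r : forall x y, r x y -> r' (phi x) (phi y).

Lemma class_map_class x : D x ->
  class_map D' r' phi [set y | D y /\ r x y] = [set y | D' y /\ r' (phi x) y].
Proof.
move=> Dx; apply/seteqP; split=> y [Dy].
  move=> [z [Dz xz] zy]; split=> //; apply: r'_trans zy; exact: phi_r.
by move=> xy; split=> //; exists x => //; split=> //; exact: r_refl.
Qed.

Lemma classes_bijP :
  set_bij (classes D r) (classes D' r') (class_map D' r' phi) <->
  (forall x y, D x -> D y -> r' (phi x) (phi y) -> r x y) /\
  (forall y, D' y -> exists2 x, D x & r' (phi x) y).
Proof.
split=> [[_ inj surj]|[inj surj]].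
  split=> [x y Dx Dy xy|y Dy].
    have : [set z | D z /\ r x z] = [set z | D z /\ r y z].
      apply: inj; rewrite ?inE; [by exists x|by exists y|].
      rewrite !class_map_class //; apply/seteqP; split=> z [Dz].
        by move=> xz; split=> //; apply: r'_trans xz; exact: r'_sym.
      by move=> yz; split=> //; exact: r'_trans yz.
    by move=> /seteqP[_ /(_ y)]; case=> //; split=> //; exact: r_refl.
  have [|_ [x Dx <-]] := surj [set z | D' z /\ r' y z]; first by exists y.
  rewrite class_map_class // => /seteqP[_ /(_ y)].
  by case=> [|_ ?]; [split=> //; exact: r'_refl|exists x].
split.
- move=> _ [x Dx <-]; rewrite class_map_class //; exists (phi x) => //.
  exact: phiD.
- move=> _ _ /set_mem[x Dx <-] /set_mem[y Dy <-]; rewrite !class_map_class //.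
  move=> /seteqP[_ /(_ (phi y))] H.
  have xy : r x y.
    apply: inj => //; have [|//] := H.
    by split; [exact: phiD|apply: r'_refl; exact: phiD].
  apply/seteqP; split=> z [Dz] ?; split=> //; last exact: r_trans xy _.
  by apply: r_trans (r_sym xy) _.
- move=> _ [y Dy <-]; have [x Dx xy] := surj y Dy.
  exists [set z | D z /\ r x z]; first by exists x.
  rewrite class_map_class //; apply/seteqP; split=> z [Dz] zz; split=> //.
    by apply: r'_trans zz; exact: r'_sym.
  exact: r'_trans zz.
Qed.

End classes_bijection.

(** * Injectivity and surjectivity on homotopy classes *)

Section homotopy_bijections.
Variable R : realType.
Local Notation I := (unitI R).

Section based.
Variables (X : extSpace) (n : nat) (alpha : Next -> X).
Implicit Types g h k : extSph R n.+1 -> X.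

Lemma based_homotopic_refl g : based_map alpha g -> based_homotopic alpha g g.
Proof.
move=> [eg gb]; eexists; first exact: hcst_homotopy eg.
by move=> m t /=; exact: gb.
Qed.

Lemma based_homotopic_sym g h :
  based_homotopic alpha g h -> based_homotopic alpha h g.
Proof.
move=> [H /hrev_homotopy hH Hb]; exists (hrev H) => // m t.
by rewrite /hrev /= Hb.
Qed.

Lemma based_homotopic_trans g h k : based_homotopic alpha g h ->
  based_homotopic alpha h k -> based_homotopic alpha g k.
Proof.
move=> [H hH Hb] [H' hH' Hb']; exists (hcat H H'); first exact: hcat_homotopy hH hH'.
by move=> m t; rewrite /hcat /=; case: ifP.
Qed.

End based.

Lemma based_map_comp (X Y : extSpace) n (f : X -> Y) (alpha : Next -> X)
    (g : extSph R n.+1 -> X) :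
  exterior_map f -> based_map alpha g -> based_map (f \o alpha) (f \o g).
Proof.
by move=> ef [eg gb]; split=> [|m /=]; [exact: exterior_comp eg ef|rewrite gb].
Qed.

Lemma based_homotopic_comp (X Y : extSpace) n (f : X -> Y) (alpha : Next -> X)
    (g h : extSph R n.+1 -> X) : exterior_map f ->
  based_homotopic alpha g h -> based_homotopic (f \o alpha) (f \o g) (f \o h).
Proof.
move=> ef [H hH Hb]; exists (f \o H); first exact: comp_homotopy ef hH.
by move=> m t /=; rewrite Hb.
Qed.

Definition pi_injective (X Y : extSpace) (f : X -> Y) : Prop :=
  (forall alpha beta : Next -> X, exterior_map alpha -> exterior_map beta ->
     ext_homotopic R (f \o alpha) (f \o beta) -> ext_homotopic R alpha beta) /\
  (forall m (alpha : Next -> X) (g h : extSph R m.+2 -> X), exterior_map alpha ->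
     based_map alpha g -> based_map alpha h ->
     based_homotopic (f \o alpha) (f \o g) (f \o h) -> based_homotopic alpha g h).

Definition pi_surjective (X Y : extSpace) (f : X -> Y) : Prop :=
  (forall beta : Next -> Y, exterior_map beta ->
     exists2 alpha : Next -> X, exterior_map alpha &
       ext_homotopic R (f \o alpha) beta) /\
  (forall m (alpha : Next -> X) (k : extSph R m.+2 -> Y), exterior_map alpha ->
     based_map (f \o alpha) k ->
     exists2 g : extSph R m.+2 -> X, based_map alpha g &
       based_homotopic (f \o alpha) (f \o g) k).

Lemma pi_injective_cancel (X Y Z : extSpace) (f : X -> Y) (g : Y -> Z) :
  exterior_map g -> pi_injective (g \o f) -> pi_injective f.
Proof.
move=> eg [inj0 inj]; split=> [a b ea eb [H hH]|m a k l ea bk bl kl].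
  by apply: inj0 => //; exists (g \o H); exact: (comp_homotopy eg hH).
by apply: inj => //; exact: (based_homotopic_comp eg kl).
Qed.

Lemma pi_surjective_cancel (X Y Z : extSpace) (f : X -> Y) (g : Y -> Z) :
  exterior_map f -> exterior_map g -> pi_injective g ->
  pi_surjective (g \o f) -> pi_surjective f.
Proof.
move=> ef eg [inj0 inj] [surj0 surj]; split=> [b eb|m a k ea bk].
  have [a ea H] := surj0 (g \o b) (exterior_comp eb eg); exists a => //.
  by apply: inj0 => //; exact: exterior_comp ea ef.
have [l bl H] := surj m a (g \o k) ea (based_map_comp eg bk); exists l => //.
apply: inj => //; first exact: exterior_comp ea ef.
exact: based_map_comp.
Qed.

Lemma pi_bijP (X Y : extSpace) (f : X -> Y) m (alpha : Next -> X) :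
  exterior_map f ->
  set_bij (@pi_e R X m.+1 alpha) (@pi_e R Y m.+1 (f \o alpha))
    (@pi_e_map R X Y m.+1 f alpha)
  <-> (forall g h : extSph R m.+2 -> X, based_map alpha g -> based_map alpha h ->
     based_homotopic (f \o alpha) (f \o g) (f \o h) -> based_homotopic alpha g h)
  /\ (forall k : extSph R m.+2 -> Y, based_map (f \o alpha) k ->
     exists2 g : extSph R m.+2 -> X, based_map alpha g &
       based_homotopic (f \o alpha) (f \o g) k).
Proof.
move=> ef; apply: classes_bijP.
- exact: based_homotopic_refl.
- exact: based_homotopic_sym.
- exact: based_homotopic_trans.
- exact: based_homotopic_refl.
- exact: based_homotopic_sym.
- exact: based_homotopic_trans.
- by move=> g; exact: based_map_comp.
- by move=> g h; exact: based_homotopic_comp.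
Qed.

Lemma htpy_set_bijP (X Y : extSpace) (f : X -> Y) : exterior_map f ->
  set_bij (@htpy_set R Next X) (@htpy_set R Next Y) (@htpy_set_map R Next X Y f) <->
  (forall alpha beta : Next -> X, exterior_map alpha -> exterior_map beta ->
     ext_homotopic R (f \o alpha) (f \o beta) -> ext_homotopic R alpha beta) /\
  (forall beta : Next -> Y, exterior_map beta ->
     exists2 alpha : Next -> X, exterior_map alpha &
       ext_homotopic R (f \o alpha) beta).
Proof.
move=> ef; apply: classes_bijP.
- exact: ext_homotopic_refl.
- exact: ext_homotopic_sym.
- exact: ext_homotopic_trans.
- exact: ext_homotopic_refl.
- exact: ext_homotopic_sym.
- exact: ext_homotopic_trans.
- by move=> g eg; exact: exterior_comp eg ef.
- by move=> g h [H hH]; exists (f \o H); exact: comp_homotopy ef hH.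
Qed.

(** * The induced maps are homomorphisms *)

Section homomorphism.
Variable m : nat.
Local Notation S := (sph R m.+2).

Lemma ct_pinch : continuous (@pinch R m).
Proof.
apply: ct_set_type; apply: ct_row => i.
rewrite (_ : (fun _ => _) = fun x : S => pinch_mx (set_val x) 0 i) //.
rewrite /pinch_mx.
have [i0|i0] := eqVneq i ord0.
  rewrite (_ : (fun _ => _) =
    fun x : S => 1 - set_val x 0 ord_max ^+ 2 *+ 2); first by ct.
  by apply/funext => x; rewrite mxE i0 eqxx.
have [im|im] := eqVneq i ord_max.
  rewrite (_ : (fun _ => _) =
    fun x : S => (set_val x 0 ord_max * set_val x 0 ord0) *+ 2); first by ct.
  by apply/funext => x; rewrite mxE (negbTE i0) im eqxx.
rewrite (_ : (fun _ => _) =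
  fun x : S => (`|set_val x 0 ord_max| * set_val x 0 i) *+ 2); first by ct.
by apply/funext => x; rewrite mxE (negbTE i0) (negbTE im).
Qed.

Lemma pinch_equator (x : S) : set_val x 0 ord_max = 0 -> pinch x = sph_base R m.+1.
Proof.
move=> x0; apply: val_inj; apply/rowP => i.
change (pinch_mx (set_val x) 0 i = (delta_mx 0 0 : 'rV[R]_m.+2) 0 i).
rewrite !mxE x0 !eqxx /= expr0n mul0rn subr0 mul0r normr0 mul0r mul0rn.
by case: eqP => // _; case: ifP.
Qed.

Lemma sph_base_last : set_val (sph_base R m.+1) 0 ord_max = 0.
Proof. by change ((delta_mx 0 0 : 'rV[R]_m.+2) 0 ord_max = 0); rewrite mxE. Qed.

Variables (X : extSpace) (alpha : Next -> X).
Implicit Types g h : extSph R m.+2 -> X.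

Lemma sph_concatE g h p :
  sph_concat g h p = if - set_val p.2 0 ord_max <= 0 then g (p.1, pinch p.2)
                     else h (p.1, pinch p.2).
Proof. by rewrite /sph_concat oppr_le0. Qed.

Lemma sph_concat_based g h :
  based_map alpha g -> based_map alpha h -> based_map alpha (sph_concat g h).
Proof.
have cS := @compact_sph R m.+2; have cp := ct_pinch.
move=> [/smapP-/(_ cS) [cg eg] gb] [/smapP-/(_ cS) [ch eh] hb].
split=> [|k]; last first.
  rewrite sph_concatE /= sph_base_last oppr0 lexx pinch_equator ?gb //.
  exact: sph_base_last.
apply/smapP => //; split=> [k|E eE].
  rewrite (_ : (fun _ => _) = fun x : S => if - set_val x 0 ord_max <= 0
    then g (k, pinch x) else h (k, pinch x)); last first.
    by apply/funext => x; rewrite sph_concatE.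
  apply: (@ct_if R _ _ (fun x : S => - set_val x 0 ord_max)); first by ct.
  - exact: (ct_comp (cg k) cp).
  - exact: (ct_comp (ch k) cp).
  - move=> x /eqP; rewrite oppr_eq0 => /eqP x0.
    by rewrite pinch_equator // gb hb.
have [m0 H] := eg _ eE; have [m1 H'] := eh _ eE.
exists (maxn m0 m1) => k; rewrite geq_max => /andP[k0 k1] x.
by rewrite /sph_concat; case: ifP => _; [exact: H|exact: H'].
Qed.

Lemma sph_concat_homotopic g g' h h' :
  based_homotopic alpha g g' -> based_homotopic alpha h h' ->
  based_homotopic alpha (sph_concat g h) (sph_concat g' h').
Proof.
have cS := @compact_sph R m.+2; have cp := ct_pinch.
move=> [G [/smap_htpyP-/(_ cS) [cG eG] G0 G1] Gb].
move=> [H [/smap_htpyP-/(_ cS) [cH eH] H0 H1] Hb].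
exists (fun p : extprod (extSph R m.+2) I =>
  if 0 <= set_val p.1.2 0 ord_max then G ((p.1.1, pinch p.1.2), p.2)
  else H ((p.1.1, pinch p.1.2), p.2)); last first.
  move=> k t /=; rewrite sph_base_last lexx pinch_equator ?Gb //.
  exact: sph_base_last.
split=> [|x|x]; last 2 first.
- by rewrite /sph_concat /= G0 H0.
- by rewrite /sph_concat /= G1 H1.
apply/smap_htpyP => //; split=> [k|E eE].
  rewrite (_ : (fun _ => _) = fun p : S * I => if - set_val p.1 0 ord_max <= 0
    then G ((k, pinch p.1), p.2) else H ((k, pinch p.1), p.2)); last first.
    by apply/funext => x; rewrite oppr_le0.
  apply: (@ct_if R _ _ (fun p : S * I => - set_val p.1 0 ord_max) 0
    (fun p => G ((k, pinch p.1), p.2)) (fun p => H ((k, pinch p.1), p.2))); first by ct.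
  - by apply: (ct_comp (f := fun p : S * I => (pinch p.1, p.2)) (cG k)); ct.
  - by apply: (ct_comp (f := fun p : S * I => (pinch p.1, p.2)) (cH k)); ct.
  - move=> x /eqP; rewrite oppr_eq0 => /eqP x0.
    by rewrite pinch_equator // Gb Hb.
have [m0 H2] := eG _ eE; have [m1 H3] := eH _ eE.
exists (maxn m0 m1) => k; rewrite geq_max => /andP[k0 k1] [x t] /=.
case: ifP => _; first exact: (H2 k k0 (pinch x, t)).
exact: (H3 k k1 (pinch x, t)).
Qed.

End homomorphism.

Lemma pi_e_map_mul (X Y : extSpace) (f : X -> Y) m (alpha : Next -> X) A B :
  exterior_map f -> @pi_e R X m.+1 alpha A -> @pi_e R X m.+1 alpha B ->
  @pi_e_map R X Y m.+1 f alpha (pi_e_mul alpha A B) =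
  pi_e_mul (f \o alpha) (pi_e_map f alpha A) (pi_e_map f alpha B).
Proof.
move=> ef [a ba <-] [b bb <-].
have fE (g h : extSph R m.+2 -> X) :
  f \o sph_concat g h = sph_concat (f \o g) (f \o h).
  by apply/funext => p; rewrite /sph_concat /=; case: ifP.
apply/seteqP; split=> k [bk].
  move=> [l [bl [g [h [[bg ag] [bh bh'] ghl]]]] lk]; split=> //.
  exists (f \o g), (f \o h); split.
  - split; first exact: based_map_comp.
    by exists g => //; apply: based_homotopic_refl; exact: based_map_comp.
  - split; first exact: based_map_comp.
    by exists h => //; apply: based_homotopic_refl; exact: based_map_comp.
  - by rewrite -fE; apply: based_homotopic_trans lk; exact: based_homotopic_comp.
move=> [g' [h' [[bg' [g [bg ag] gg']] [bh' [h [bh bh2] hh']] ghk]]]; split=> //.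
exists (sph_concat g h).
  have bgh := sph_concat_based bg bh.
  by split=> //; exists g, h; split=> //; exact: based_homotopic_refl.
by apply: based_homotopic_trans ghk; rewrite fE; exact: sph_concat_homotopic.
Qed.

Lemma weak_equivalenceP (X Y : extSpace) (f : X -> Y) : exterior_map f ->
  weak_equivalence R f <-> pi_injective f /\ pi_surjective f.
Proof.
move=> ef; split=> [[_ /(htpy_set_bijP ef) [inj0 surj0] H]|].
  split; split=> // m alpha.
    by move=> g h ea; have [/(pi_bijP m alpha ef) [inj _] _] := H m alpha ea; exact: inj.
  by move=> k ea; have [/(pi_bijP m alpha ef) [_ surj] _] := H m alpha ea; exact: surj.
move=> [[inj0 inj] [surj0 surj]]; split=> //; first exact/htpy_set_bijP.
move=> m alpha ea; split; last by move=> A B; exact: pi_e_map_mul.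
by apply/pi_bijP => //; split=> [g h|k]; [exact: inj|exact: surj].
Qed.

End homotopy_bijections.

(** * Change of base ray along a homotopy *)

Section change_of_base.
Variable R : realType.
Local Notation I := (unitI R).

Section fold.
Variable n : nat.
Local Notation S := (sph R n.+1).
Local Notation e0 := (sph_base R n).

Lemma dot_base (x : 'rV[R]_n.+1) : dot (set_val e0) x = x 0 0.
Proof.
rewrite /dot (_ : set_val e0 = delta_mx 0 0) // big_ord_recl big1 ?addr0 => [|i _].
  by rewrite mxE !eqxx mul1r.
by rewrite mxE /= mul0r.
Qed.

Lemma set_val_to_sph1 (x : 'rV[R]_n.+1) : sqnorm x = 1 -> set_val (to_sph x) = x.
Proof.
by move=> x1; rewrite set_val_to_sph ?x1 ?oner_eq0 // norm2_eq1 // invr1 scale1r.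
Qed.

Lemma base_coord0 : set_val e0 0 0 = 1.
Proof. by rewrite (_ : set_val e0 = delta_mx 0 0) // mxE !eqxx. Qed.

(** With [s] the coordinate of [x] along the base point, this is [e0 - 2 min(s, 0) x].
    It collapses the hemisphere [s >= 0] to the base point, and on the other
    hemisphere it doubles the angle with the antipode of the base point.  The factor
    [1] brings it to the form in which [dotZ] and [sqnormZ] compute its norm. *)
Definition fold_mx (x : 'rV[R]_n.+1) : 'rV[R]_n.+1 :=
  1 *: set_val e0 + (- (2 * Num.min (x 0 0) 0)) *: x.

Definition fold (x : S) : S := to_sph (fold_mx (set_val x)).

Lemma sqnorm_fold (x : S) : sqnorm (fold_mx (set_val x)) = 1.
Proof.
rewrite /fold_mx sqnormD !sqnormZ dotZ dot_base !sph_eq1.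
by case: (leP (set_val x 0 0) 0) => x0; ring.
Qed.

Lemma set_val_fold (x : S) : set_val (fold x) = fold_mx (set_val x).
Proof. by rewrite set_val_to_sph1 // sqnorm_fold. Qed.

Lemma fold_hemisphere (x : S) : 0 <= set_val x 0 0 -> fold x = e0.
Proof.
move=> x0; apply: val_inj; change (set_val (fold x) = set_val e0).
by rewrite set_val_fold /fold_mx min_r // mulr0 oppr0 scale0r addr0 scale1r.
Qed.

Lemma fold_base : fold e0 = e0.
Proof. by apply: fold_hemisphere; rewrite base_coord0. Qed.

Lemma ct_fold : continuous fold.
Proof.
apply: ct_to_sph_comp; last by move=> x; rewrite sqnorm_fold oner_eq0.
by rewrite /fold_mx; ct.
Qed.

Definition fold_path (p : S * I) : S :=
  to_sph ((1 - set_val p.2) *: set_val p.1 + set_val p.2 *: set_val (fold p.1)).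

(** A point and its image under [fold] are never antipodal, since their scalar
    product is [|x_0|]. *)
Lemma fold_path_neq0 (p : S * I) :
  sqnorm ((1 - set_val p.2) *: set_val p.1 + set_val p.2 *: set_val (fold p.1)) != 0.
Proof.
case: p => x t /=; rewrite gt_eqF // sqnormD !sqnormZ dotZ !sph_eq1 !mulr1.
have d0 : 0 <= dot (set_val x) (set_val (fold x)).
  rewrite set_val_fold /fold_mx.
  have -> : dot (set_val x)
       (1 *: set_val e0 + - (2 * Num.min (set_val x 0 0) 0) *: set_val x)
     = dot (set_val e0) (set_val x) - 2 * Num.min (set_val x 0 0) 0 * sqnorm (set_val x).
    rewrite /dot /sqnorm mulr_sumr -sumrB; apply: eq_bigr => i _.
    by rewrite !mxE; ring.
  rewrite dot_base sph_eq1 mulr1.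
  by case: (leP (set_val x 0 0) 0) => x0; lra.
have t0 := unitI_ge0 t; have t1 := unitI_le1 t.
have : 0 <= (1 - set_val t) * set_val t * dot (set_val x) (set_val (fold x)) *+ 2.
  by rewrite mulrn_wge0 // mulr_ge0 // mulr_ge0 // subr_ge0.
nra.
Qed.

Lemma ct_fold_path : continuous fold_path.
Proof.
by have := ct_fold => cf; apply: ct_to_sph_comp; [ct|exact: fold_path_neq0].
Qed.

Lemma fold_path0 x : fold_path (x, unitI0 R) = x.
Proof. by rewrite /fold_path /= unitI0E subr0 scale1r scale0r addr0 to_sphK. Qed.

Lemma fold_path1 x : fold_path (x, unitI1 R) = fold x.
Proof. by rewrite /fold_path /= unitI1E subrr scale0r scale1r add0r to_sphK. Qed.

Lemma fold_path_base t : fold_path (e0, t) = e0.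
Proof. by rewrite /fold_path /= fold_base -scalerDl subrK scale1r to_sphK. Qed.

End fold.

Section trace.
Variables (X : extSpace) (n : nat).
Local Notation S := (sph R n.+1).
Local Notation e0 := (sph_base R n).

Definition fold_map (k : extSph R n.+1 -> X) : extSph R n.+1 -> X :=
  fun p => k (p.1, fold p.2).

Lemma fold_map_homotopic (alpha : Next -> X) (k : extSph R n.+1 -> X) :
  based_map alpha k -> based_homotopic alpha k (fold_map k).
Proof.
have cS := @compact_sph R n.+1; have cf := @ct_fold_path n.
move=> [/smapP-/(_ cS) [ck ek] kb].
exists (fun p : extprod (extSph R n.+1) I => k (p.1.1, fold_path (p.1.2, p.2))).
  split=> [|[m x]|[m x]] /=; last 2 first.
  - by rewrite fold_path0.
  - by rewrite /fold_map fold_path1.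
  apply/smap_htpyP => //; split=> [m|E /ek [m0 H]].
    by apply: (ct_comp (f := fun p : S * I => fold_path (p.1, p.2)) (ck m)); ct.
  by exists m0 => m mm0 p; exact: H.
by move=> m t /=; rewrite fold_path_base.
Qed.

(** The trace of [L] on the base point runs along the path [sigma] and back.  The
    hemisphere that [fold] collapses gives room to contract this trace within
    [sigma], by cutting [g] off from below by the height of the point. *)
Lemma trace_homotopic (alpha : Next -> X) (k0 k1 : extSph R n.+1 -> X)
    (L : extprod (extSph R n.+1) I -> X) (sigma : nat -> I -> X) (g : I -> R) :
  based_map alpha k0 -> based_map alpha k1 -> ext_homotopy k0 k1 L ->
  smap sigma -> continuous g -> g (unitI0 R) = 1 -> g (unitI1 R) = 1 ->
  (forall m t, L ((m, e0), t) = sigma m (clamp (g t))) ->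
  based_homotopic alpha k0 k1.
Proof.
move=> b0 b1 [/smap_htpyP-/(_ (@compact_sph R n.+1)) [cL eL] L0 L1] [cs es] cg g0 g1 Ls.
have cf := @ct_fold n.
have s1 m : sigma m (unitI1 R) = alpha m.
  by rewrite -(clamp_ge1 (lexx 1)) -g0 -Ls L0; case: b0.
pose M (p : extprod (extSph R n.+1) I) : X :=
  if set_val p.1.2 0 0 <= 0 then L ((p.1.1, fold p.1.2), p.2)
  else sigma p.1.1 (clamp (Num.max (g p.2) (set_val p.1.2 0 0))).
apply: based_homotopic_trans (fold_map_homotopic b0) _.
apply: based_homotopic_trans _ (based_homotopic_sym (fold_map_homotopic b1)).
have sx m (x : S) : (set_val x 0 0 <= 0) = false ->
    alpha m = k0 (m, fold x) /\ alpha m = k1 (m, fold x).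
  move/negbT; rewrite -ltNge => /ltW /fold_hemisphere ->.
  by case: b0 => _ ->; case: b1 => _ ->.
exists M => [|m t]; last first.
  by rewrite /M /= base_coord0 lt_geF ?ltr01 // clamp_ge1 ?s1 // le_max lexx orbT.
split=> [|[m x]|[m x]]; last 2 first.
- rewrite /M /fold_map /=; case: ifP => x0; first by rewrite L0.
  by rewrite clamp_ge1 ?le_max ?g0 ?lexx // s1; case: (sx m x x0).
- rewrite /M /fold_map /=; case: ifP => x0; first by rewrite L1.
  by rewrite clamp_ge1 ?le_max ?g1 ?lexx // s1; case: (sx m x x0).
apply/smap_htpyP; first exact: compact_sph.
split=> [m|E eE].
  apply: (@ct_if R _ _ (fun p : S * I => set_val p.1 0 0) 0
    (fun p => L ((m, fold p.1), p.2))
    (fun p => sigma m (clamp (Num.max (g p.2) (set_val p.1 0 0))))).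
  - by ct.
  - by apply: (ct_comp (f := fun p : S * I => (fold p.1, p.2)) (cL m)); ct.
  - by apply: (ct_comp (g := sigma m)) => //; ct.
  move=> [x t] /= x0; rewrite fold_hemisphere ?x0 // Ls.
  by case: (leP 0 (g t)) => [//|/ltW gt]; rewrite !clamp_le0.
have [m0 H] := eL _ eE; have [m1 H'] := es _ eE.
exists (maxn m0 m1) => m; rewrite geq_max => /andP[mm0 mm1] [x t].
by rewrite /M /=; case: ifP => _; [exact: (H m mm0 (fold x, t))|exact: H'].
Qed.

End trace.

Section homotopic_to_id.
Variables (X : extSpace) (phi : X -> X) (H : extprod X I -> X).
Hypothesis hH : ext_homotopy phi id H.

Let smap_trace (alpha : Next -> X) : exterior_map alpha ->
  smap (fun m t => H (alpha m, t)).
Proof.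
move=> ea; have [eH _ _] := precomp_homotopy ea hH.
by have /smapP-/(_ (@compact_unitI R)) := eH.
Qed.

(** Two maps with based homotopic images under [phi] are freely homotopic: follow
    [H] backwards, then the given homotopy, then [H] forwards. *)
Lemma pi_injective_htpy_id : pi_injective R phi.
Proof.
have [eH H0 H1] := hH.
split=> [a b ea eb ab|m a k l ea bk bl [B hB Bb]].
  have Ha : ext_homotopic R (phi \o a) a by eexists; exact: precomp_homotopy ea hH.
  have Hb : ext_homotopic R (phi \o b) b by eexists; exact: precomp_homotopy eb hH.
  apply: ext_homotopic_trans Hb; apply: ext_homotopic_trans ab.
  exact: ext_homotopic_sym.
have hk := precomp_homotopy bk.1 hH; have hl := precomp_homotopy bl.1 hH.
have hL := hcat_homotopy (hcat_homotopy (hrev_homotopy hk) hB) hl.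
apply: (@trace_homotopic _ _ _ _ _ _ (fun m t => H (a m, t))
  (fun t : I => Num.max (1 - 4 * set_val t) (2 * set_val t - 1)) bk bl hL).
- exact: smap_trace.
- by ct.
- by rewrite unitI0E; case: leP; lra.
- by rewrite unitI1E; case: leP; lra.
move=> j t; have t0 := unitI_ge0 t; have t1 := unitI_le1 t.
rewrite /hcat /hrev /=; case: ifP => t2.
  rewrite set_val_clamp ?mulr_ge0 ?ler0n //=; last by lra.
  case: ifP => t4.
    rewrite !set_val_clamp; last by lra.
    rewrite bk.2; congr (H (_, clamp _)).
    by rewrite max_l; lra.
  rewrite Bb /= -H0 clamp_le0 // ge_max; apply/andP; split; lra.
rewrite bl.2; congr (H (_, clamp _)).
by rewrite max_r; lra.
Qed.

(** A preimage of [k] is obtained by attaching to [k] the whisker that [H] traces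
    from the base ray of [k] to [a]. *)
Lemma pi_surjective_htpy_id : exterior_map phi -> pi_surjective R phi.
Proof.
move=> ephi; have [eH H0 H1] := hH; split=> [b eb|m a k ea bk].
  by exists b => //; eexists; exact: precomp_homotopy eb hH.
have [cs es] := smap_trace ea; have cf := @ct_fold m.+1.
have cS := @compact_sph R m.+2.
have [/smapP-/(_ cS) [ck ek] kb] := bk.
(* the whisker of [k] along the trace of [a], shrunk back by the parameter [t] *)
pose W (p : extprod (extSph R m.+2) I) : X :=
  if set_val p.1.2 0 0 <= 0 then k (p.1.1, fold p.1.2)
  else H (a p.1.1, clamp (set_val p.1.2 0 0 * (1 - set_val p.2))).
pose k' : extSph R m.+2 -> X := fun p => W (p, unitI0 R).
have eW : exterior_map W.
  apply/smap_htpyP => //; split=> [j|E eE].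
    apply: (@ct_if R _ _ (fun p : sph R m.+2 * I => set_val p.1 0 0) 0
      (fun p => k (j, fold p.1))
      (fun p => H (a j, clamp (set_val p.1 0 0 * (1 - set_val p.2))))).
    - by ct.
    - by apply: (ct_comp (f := fun p : sph R m.+2 * I => fold p.1) (ck j)); ct.
    - by apply: (ct_comp (f := fun p : sph R m.+2 * I =>
        clamp (set_val p.1 0 0 * (1 - set_val p.2))) (cs j)); ct.
    move=> [x t] /= x0; rewrite fold_hemisphere ?x0 // kb mul0r clamp_le0 //.
  have [m0 Hm] := ek _ eE; have [m1 Hm'] := es _ eE.
  exists (maxn m0 m1) => j; rewrite geq_max => /andP[mm0 mm1] [x t].
  by rewrite /W /=; case: ifP => _; [exact: Hm|exact: Hm'].
have bk' : based_map a k'.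
  split; last first.
    move=> j; rewrite /k' /W /= base_coord0 lt_geF ?ltr01 //.
    by rewrite clamp_ge1 ?H1 // unitI0E subr0 mulr1.
  apply/smapP => //; have /smap_htpyP-/(_ cS) [cW eW'] := eW.
  split=> [j|E /eW' [m0 Hm]].
    by apply: (ct_comp (f := fun x : sph R m.+2 => (x, unitI0 R)) (cW j)); ct.
  by exists m0 => j mm0 x; exact: (Hm j mm0 (x, unitI0 R)).
exists k' => //.
have hW : ext_homotopy k' (fold_map k) W.
  split=> // -[j x]; rewrite /W /fold_map /=; case: ifP => // x0.
  rewrite unitI1E subrr mulr0 clamp_le0 // H0 fold_hemisphere ?kb //.
  by apply: ltW; rewrite ltNge x0.
have bfk : based_map (phi \o a) (fold_map k).
  split=> [|j]; last by rewrite /fold_map /= fold_base kb.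
  apply/smapP => //; split=> [j|E /ek [m0 Hm]]; first exact: (ct_comp (ck j) cf).
  by exists m0 => j mm0 x; exact: Hm.
apply: based_homotopic_trans _ (based_homotopic_sym (fold_map_homotopic bk)).
have hL := hcat_homotopy (precomp_homotopy bk'.1 hH) hW.
apply: (@trace_homotopic _ _ _ _ _ _ (fun j t => H (a j, clamp (1 - set_val t)))
  (fun t : I => `|2 * set_val t - 1|) (based_map_comp ephi bk') bfk hL).
- split=> [j|E /es [m0 Hm]]; last by exists m0 => j mm0 t; exact: Hm.
  by apply: (ct_comp (f := fun t : I => clamp (1 - set_val t)) (cs j)); ct.
- by ct.
- by rewrite unitI0E mulr0 sub0r normrN normr1.
- by rewrite unitI1E mulr1 (_ : 2 - 1 = 1 :> R) ?normr1 //; ring.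
move=> j t; have t0 := unitI_ge0 t; have t1 := unitI_le1 t.
rewrite /hcat /=; case: ifP => t2.
  rewrite bk'.2 ler0_norm; last by lra.
  rewrite set_val_clamp; last by lra.
  by congr (H (_, clamp _)); ring.
rewrite /W /= base_coord0 lt_geF ?ltr01 // ger0_norm; last by lra.
rewrite set_val_clamp; last by lra.
by congr (H (_, clamp _)); ring.
Qed.

End homotopic_to_id.

End change_of_base.

(** * Extending and lifting over disks *)

Section help.
Variable R : realType.
Local Notation I := (unitI R).

Lemma smap_comp (K : topologicalType) (X Y : extSpace) (f : X -> Y)
    (g : nat -> K -> X) :
  exterior_map f -> smap g -> smap (fun m k => f (g m k)).
Proof. by move=> [cf ef] [cg eg]; split=> [m|E /ef /eg //]; exact: ct_comp. Qed.

Lemma smap_precomp (K L : topologicalType) (X : extSpace) (g : nat -> K -> X)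
    (h : L -> K) :
  continuous h -> smap g -> smap (fun m l => g m (h l)).
Proof.
move=> ch [cg eg]; split=> [m|E /eg [m0 H]]; first exact: ct_comp.
by exists m0 => m mm0 l; exact: H.
Qed.

Lemma smap_if (K : topologicalType) (X : extSpace) (a : K -> R) (c : R)
    (g h : nat -> K -> X) :
  continuous a -> smap g -> smap h -> (forall m k, a k = c -> g m k = h m k) ->
  smap (fun m k => if a k <= c then g m k else h m k).
Proof.
move=> ca [cg eg] [ch eh] gh; split=> [m|E eE].
  by apply: (@ct_if R _ _ a c (g m) (h m)) => // k; exact: gh.
have [m0 H] := eg _ eE; have [m1 H'] := eh _ eE.
exists (maxn m0 m1) => m; rewrite geq_max => /andP[mm0 mm1] k.
by case: ifP => _; [exact: H|exact: H'].
Qed.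

Section concatenation.
Variables (K : topologicalType) (X : extSpace).

Definition scat (P Q : nat -> K * I -> X) : nat -> K * I -> X := fun m q =>
  if set_val q.2 <= 2^-1 then P m (q.1, clamp (2 * set_val q.2))
  else Q m (q.1, clamp (2 * set_val q.2 - 1)).

Lemma smap_scat P Q : smap P -> smap Q ->
  (forall m k, P m (k, unitI1 R) = Q m (k, unitI0 R)) -> smap (scat P Q).
Proof.
move=> sP sQ PQ.
apply: (smap_if (a := fun q : K * I => set_val q.2) (c := 2^-1)
  (g := fun m q => P m (q.1, clamp (2 * set_val q.2)))
  (h := fun m q => Q m (q.1, clamp (2 * set_val q.2 - 1)))); first by ct.
- apply: (smap_precomp (h := fun q : K * I => (q.1, clamp (2 * set_val q.2)))) => //.
  by ct.
- apply: (smap_precomp (h := fun q : K * I =>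
    (q.1, clamp (2 * set_val q.2 - 1)))) => //.
  by ct.
move=> m [k t] /= ->; rewrite mulfV // subrr clamp_ge1 // clamp_le0 //.
Qed.

Lemma scat0 P Q m k : scat P Q m (k, unitI0 R) = P m (k, unitI0 R).
Proof. by rewrite /scat /= unitI0E invr_ge0 ler0n mulr0 clamp_le0. Qed.

Lemma scat1 P Q m k : scat P Q m (k, unitI1 R) = Q m (k, unitI1 R).
Proof.
rewrite /scat /= unitI1E ifF; last by apply/negbTE; rewrite -ltNge; lra.
by rewrite clamp_ge1 //; lra.
Qed.

End concatenation.

Section path_concatenation.
Variables (K : topologicalType) (X : extSpace).

(** Concatenation in the first interval variable, the second one being the
    parameter of a homotopy between such paths. *)
Definition pcat (P Q : nat -> (K * I) * I -> X) : nat -> (K * I) * I -> X :=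
  fun m q => scat (fun m r => P m ((r.1.1, r.2), r.1.2))
    (fun m r => Q m ((r.1.1, r.2), r.1.2)) m ((q.1.1, q.2), q.1.2).

Lemma smap_pcat P Q : smap P -> smap Q ->
  (forall m k s, P m ((k, unitI1 R), s) = Q m ((k, unitI0 R), s)) -> smap (pcat P Q).
Proof.
move=> sP sQ PQ.
apply: (smap_precomp (h := fun q : (K * I) * I => ((q.1.1, q.2), q.1.2))); first by ct.
apply: smap_scat => [||m [k s]]; last exact: PQ.
- by apply: (smap_precomp (h := fun r : (K * I) * I => ((r.1.1, r.2), r.1.2))) => //; ct.
- by apply: (smap_precomp (h := fun r : (K * I) * I => ((r.1.1, r.2), r.1.2))) => //; ct.
Qed.

Lemma pcat0 P Q m k s : pcat P Q m ((k, unitI0 R), s) = P m ((k, unitI0 R), s).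
Proof. by rewrite /pcat scat0. Qed.

Lemma pcat1 P Q m k s : pcat P Q m ((k, unitI1 R), s) = Q m ((k, unitI1 R), s).
Proof. by rewrite /pcat scat1. Qed.

Lemma eq_pcat P Q P' Q' m m' q q' : q.1 = q'.1 ->
  (forall r, P m (r, q.2) = P' m' (r, q'.2)) ->
  (forall r, Q m (r, q.2) = Q' m' (r, q'.2)) -> pcat P Q m q = pcat P' Q' m' q'.
Proof.
case: q q' => [[k l] s] [[k' l'] s'] /= [<- <-] PP QQ.
by rewrite /pcat /scat /=; case: ifP.
Qed.

End path_concatenation.

Section cone.
Variable n : nat.
Local Notation S := (sph R n.+1).
Local Notation D := (disk R n.+1).

(** [P] is read in polar coordinates.  The angle [to_sph] jumps at the centre, where
    [P] must not depend on it. *)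
Definition cone T (P : nat -> (S * I) * I -> T) : nat -> D * I -> T := fun m q =>
  P m ((to_sph (set_val q.1), clamp (norm2 (set_val q.1))), q.2).

Lemma ct_cone (T : topologicalType) (P : (S * I) * I -> T) : continuous P ->
  (forall b b' s, P ((b, unitI0 R), s) = P ((b', unitI0 R), s)) ->
  continuous (fun q : D * I =>
    P ((to_sph (set_val q.1), clamp (norm2 (set_val q.1))), q.2)).
Proof.
move=> cP P0.
apply: (@ct_tube (D * I)%type (I * I)%type S T (fun a => P ((a.2, a.1.1), a.1.2))
  (fun q => (clamp (norm2 (set_val q.1)), q.2)) (fun q => to_sph (set_val q.1))).
- exact: compact_sph.
- by apply: (ct_comp (g := P)) => //; ct.
- by ct.
move=> [x t]; have [x0|x0] := eqVneq (sqnorm (set_val x)) 0.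
  right => c /=; rewrite /norm2 x0 sqrtr0 clamp_le0 //.
left; have cv : continuous (fun q : D * I => set_val q.1) by ct.
apply: (@continuous_comp _ _ _ (fun q : D * I => set_val q.1)); first exact: cv.
exact: ct_to_sph.
Qed.

Lemma smap_cone (X : extSpace) (P : nat -> (S * I) * I -> X) : smap P ->
  (forall m b b' s, P m ((b, unitI0 R), s) = P m ((b', unitI0 R), s)) ->
  smap (cone P).
Proof.
move=> [cP eP] P0; split=> [m|E /eP [m0 H]]; last by exists m0 => m mm0 q; exact: H.
by apply: ct_cone => // b b' s; exact: P0.
Qed.

Lemma cone_sph T (P : nat -> (S * I) * I -> T) m b s :
  cone P m (sph_disk b, s) = P m ((b, unitI1 R), s).
Proof.
rewrite /cone /=.
change (P m ((to_sph (set_val b), clamp (norm2 (set_val b))), s) =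
  P m ((b, unitI1 R), s)).
by rewrite to_sphK norm2_eq1 ?sph_eq1 // clamp_ge1.
Qed.

End cone.

Section hemispheres.
Variable n : nat.
Local Notation S := (sph R n.+1).
Local Notation D := (disk R n.+1).
Local Notation e0 := (sph_base R n).

Definition snoc (z : 'rV[R]_n.+1) (s : R) : 'rV[R]_n.+2 :=
  \row_i (if unlift ord_max i is Some j then z 0 j else s).

Definition init (x : 'rV[R]_n.+2) : 'rV[R]_n.+1 := \row_j x 0 (lift ord_max j).

Lemma init_snoc z s : init (snoc z s) = z.
Proof. by apply/rowP => j; rewrite !mxE liftK. Qed.

Lemma last_snoc z s : snoc z s 0 ord_max = s.
Proof. by rewrite mxE unlift_none. Qed.

Lemma sqnorm_init x : sqnorm x = sqnorm (init x) + x 0 ord_max ^+ 2.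
Proof.
rewrite /sqnorm big_ord_recr /=; congr (_ + _); apply: eq_bigr => j _.
by rewrite mxE; congr (x 0 _ ^+ 2); apply: val_inj => /=; rewrite /bump leqNgt ltn_ord.
Qed.

Lemma ct_init (T : topologicalType) (g : T -> 'rV[R]_n.+2) :
  continuous g -> continuous (fun x => init (g x)).
Proof.
move=> cg; apply: ct_row => i.
rewrite (_ : (fun x => _) = fun x => g x 0 (lift ord_max i)); first by ct.
by apply/funext => x; rewrite mxE.
Qed.

Lemma ct_snoc (T : topologicalType) (g : T -> 'rV[R]_n.+1) (a : T -> R) :
  continuous g -> continuous a -> continuous (fun x => snoc (g x) (a x)).
Proof.
move=> cg ca; apply: ct_row => i.
case: (unliftP ord_max i) => [j ->|->].
  rewrite (_ : (fun x => _) = fun x => g x 0 j); first by ct.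
  by apply/funext => x; rewrite mxE liftK.
rewrite (_ : (fun x => _) = a) //.
by apply/funext => x; rewrite mxE unlift_none.
Qed.

(** The graph of the last coordinate over the disk: the upper hemisphere for
    [eps = 1], the lower one for [eps = -1]. *)
Definition hemi_mx (eps : R) (z : D) : 'rV[R]_n.+2 :=
  snoc (set_val z) (eps * Num.sqrt (1 - sqnorm (set_val z))).

Definition hemi eps z : sph R n.+2 := to_sph (hemi_mx eps z).

Definition proj (x : sph R n.+2) : D := to_disk (init (set_val x)).

Lemma sqnorm_hemi eps z : eps ^+ 2 = 1 -> sqnorm (hemi_mx eps z) = 1.
Proof.
move=> e1; rewrite sqnorm_init /hemi_mx init_snoc last_snoc exprMn e1 mul1r.
by rewrite sqr_sqrtr ?subr_ge0 ?disk_le1 // addrC subrK.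
Qed.

Lemma set_val_hemi eps z : eps ^+ 2 = 1 -> set_val (hemi eps z) = hemi_mx eps z.
Proof. by move=> e1; rewrite set_val_to_sph1 // sqnorm_hemi. Qed.

Lemma ct_hemi eps : eps ^+ 2 = 1 -> continuous (hemi eps).
Proof.
move=> e1; apply: ct_to_sph_comp => [|z]; last by rewrite sqnorm_hemi // oner_eq0.
by apply: (ct_snoc (g := fun z : D => set_val z)
  (a := fun z : D => eps * Num.sqrt (1 - sqnorm (set_val z)))); ct.
Qed.

Lemma ct_proj : continuous proj.
Proof. by apply: ct_to_disk; apply: ct_init; exact: ct_set_val. Qed.

Lemma proj_hemi eps z : eps ^+ 2 = 1 -> proj (hemi eps z) = z.
Proof. by move=> e1; rewrite /proj set_val_hemi // /hemi_mx init_snoc to_diskK. Qed.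

Lemma hemi_last eps z : eps ^+ 2 = 1 ->
  set_val (hemi eps z) 0 ord_max = eps * Num.sqrt (1 - sqnorm (set_val z)).
Proof. by move=> e1; rewrite set_val_hemi // /hemi_mx last_snoc. Qed.

Lemma hemi_sph eps (b : S) : hemi eps (sph_disk b) = hemi 1 (sph_disk b).
Proof.
rewrite /hemi /hemi_mx (_ : set_val (sph_disk b) = set_val b) //.
by rewrite sph_eq1 subrr sqrtr0 !mulr0.
Qed.

Lemma hemi_base eps : eps ^+ 2 = 1 -> hemi eps (sph_disk e0) = sph_base R n.+1.
Proof.
move=> e1; apply: val_inj.
change (set_val (hemi eps (sph_disk e0)) = set_val (sph_base R n.+1)).
rewrite set_val_hemi // /hemi_mx (_ : set_val (sph_disk e0) = set_val e0) //.
rewrite sph_eq1 subrr sqrtr0 mulr0; apply/rowP => i.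
rewrite (_ : set_val (sph_base R n.+1) = delta_mx 0 0) //.
rewrite (_ : set_val e0 = delta_mx 0 0) // mxE.
case: (unliftP ord_max i) => [j ->|->]; last by rewrite mxE.
by rewrite !mxE -!val_eqE /= /bump leqNgt ltn_ord.
Qed.

Lemma proj_equator (x : sph R n.+2) : set_val x 0 ord_max = 0 ->
  exists b : S, proj x = sph_disk b.
Proof.
move=> x0; exists (to_sph (init (set_val x))).
have x1 : sqnorm (init (set_val x)) = 1.
  by have := sph_eq1 x; rewrite sqnorm_init x0 expr0n addr0.
by rewrite /proj -to_disk_sph set_val_to_sph1.
Qed.

(** The chord from the base point to a boundary point of the disk: in these
    coordinates a map on the disk is a based contraction of its restriction to the
    boundary. *)
Definition chord (q : S * I) : D :=
  to_disk ((1 - set_val q.2) *: set_val e0 + set_val q.2 *: set_val q.1).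

Lemma ct_chord : continuous chord.
Proof. by rewrite /chord; ct. Qed.

Lemma chord0 b : chord (b, unitI0 R) = sph_disk e0.
Proof. by rewrite /chord /= unitI0E subr0 scale1r scale0r addr0 to_disk_sph. Qed.

Lemma chord1 b : chord (b, unitI1 R) = sph_disk b.
Proof. by rewrite /chord /= unitI1E subrr scale1r scale0r add0r to_disk_sph. Qed.

Lemma chord_base t : chord (e0, t) = sph_disk e0.
Proof. by rewrite /chord /= -scalerDl subrK scale1r to_disk_sph. Qed.

End hemispheres.

(** The homotopy extension and lifting property for the pairs [(D^k, S^(k-1))]. *)
Definition help_property (X Y : extSpace) (f : X -> Y) : Prop :=
  forall k (u : nat -> sph R k -> X) (v : nat -> disk R k -> Y)
    (w : nat -> sph R k * I -> Y), smap u -> smap v -> smap w ->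
  (forall m b, w m (b, unitI0 R) = f (u m b)) ->
  (forall m b, w m (b, unitI1 R) = v m (sph_disk b)) ->
  exists2 ut : nat -> disk R k -> X,
    smap ut /\ (forall m b, ut m (sph_disk b) = u m b)
  & exists wt : nat -> disk R k * I -> Y,
    [/\ smap wt, forall m x, wt m (x, unitI0 R) = f (ut m x),
      forall m x, wt m (x, unitI1 R) = v m x &
      forall m b t, wt m (sph_disk b, t) = w m (b, t)].

Section lifting.
Variables (X Y : extSpace) (f : X -> Y).
Hypothesis ef : exterior_map f.
Hypothesis f_inj : pi_injective R f.
Hypothesis f_surj : pi_surjective R f.

Lemma smap_ray (K : topologicalType) (Z : extSpace) (g : nat -> K -> Z) (k : K) :
  smap g -> exterior_map ((fun m => g m k) : Next -> Z).
Proof.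
move=> [_ eg]; apply/Next_mapP => E /eg [m0 H].
by exists m0 => m /H; apply.
Qed.

(** Contracting the disk [V] along its chords is a based contraction of [f \o u], so
    injectivity contracts [u].  For [S^0] this is injectivity on homotopy classes of
    discrete rays, applied to the two points of the sphere. *)
Lemma sphere_contractible n (u : nat -> sph R n.+1 -> X)
    (V : nat -> disk R n.+1 -> Y) : smap u -> smap V ->
  (forall m b, V m (sph_disk b) = f (u m b)) ->
  exists U : nat -> sph R n.+1 * I -> X, [/\ smap U,
    forall m b, U m (b, unitI1 R) = u m b &
    forall m b, U m (b, unitI0 R) = u m (sph_base R n)].
Proof.
have [inj0 inj] := f_inj; case: n u V => [|n] u V su sV Vu.
  pose e0 : sph R 1 := sph_base R 0; pose e1 : sph R 1 := to_sph (- set_val e0).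
  have e10 : sqnorm (- set_val e0) = 1.
    by rewrite -scaleN1r sqnormZ sph_eq1 sqrrN expr1n mulr1.
  have sph1 (b : sph R 1) : b = if set_val b 0 0 <= 0 then e1 else e0.
    have : set_val b 0 0 ^+ 2 = 1.
      by rewrite -(sph_eq1 b) /sqnorm big_ord_recl big_ord0 addr0.
    move=> /eqP; rewrite sqrf_eq1 => /orP b0.
    apply: val_inj; apply/rowP => i; rewrite (ord1 i).
    change (set_val b 0 0 = set_val (if set_val b 0 0 <= 0 then e1 else e0) 0 0).
    case: b0 => /eqP b0; rewrite b0.
      by rewrite lt_geF ?ltr01 // base_coord0.
    by rewrite lerN10 set_val_to_sph1 // mxE base_coord0.
  have [] := inj0 (fun m => u m e0) (fun m => u m e1);
    [exact: smap_ray|exact: smap_ray| |].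
    exists (fun p : extprod Next I => V p.1 (chord (e1, p.2))).
    split=> [|m|m] /=; last 2 first.
    - by rewrite chord0 Vu.
    - by rewrite chord1 Vu.
    apply/smapP; first exact: compact_unitI.
    apply: (smap_precomp (h := fun t => chord (e1, t))) => //.
    by apply: (ct_comp (f := fun t => (e1, t)) (@ct_chord 0)); ct.
  move=> h [/smapP-/(_ (@compact_unitI R)) sh h0 h1].
  exists (fun m (q : sph R 1 * I) => if set_val q.1 0 0 <= 0 then h (m, q.2) else u m e0).
  split=> [|m b|m b] /=; last 2 first.
  - by rewrite [in RHS](sph1 b); case: ifP.
  - by case: ifP => // _; rewrite h0.
  apply: (smap_if (a := fun q : sph R 1 * I => set_val q.1 0 0)).
  - by ct.
  - by apply: (smap_precomp (h := snd) _ sh); exact: ct_snd.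
  - by apply: (smap_precomp (h := fun=> e0) _ su); exact: ct_cst.
  - move=> m q q0; have := sph1 q.1; rewrite q0 lexx => qe.
    move: q0; rewrite qe set_val_to_sph1 // mxE base_coord0 => /eqP.
    by rewrite oppr_eq0 oner_eq0.
pose e0 := sph_base R n.+1; have cS := @compact_sph R n.+2.
pose a : Next -> X := fun m => u m e0.
have ea : exterior_map a by exact: smap_ray.
have := inj n a (fun p => a p.1) (fun p => u p.1 p.2) ea.
case.
- split=> //; apply/smapP => //.
  by apply: (smap_precomp (h := fun=> e0) _ su); exact: ct_cst.
- by split=> //; apply/smapP.
- exists (fun p : extprod (extSph R n.+2) I => V p.1.1 (chord (p.1.2, p.2))).
    split=> [|m|m] /=; last 2 first.
    + by rewrite chord0 Vu.
    + by rewrite chord1 Vu.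
    apply/smap_htpyP => //.
    apply: (smap_precomp (h := fun p : sph R n.+2 * I => chord (p.1, p.2)) _ sV).
    by apply: (ct_comp (f := fun p : sph R n.+2 * I => (p.1, p.2)) (@ct_chord n.+1)); ct.
  by move=> m t /=; rewrite chord_base Vu.
move=> H [/smap_htpyP-/(_ cS) sH H0 H1] _.
by exists (fun m q => H ((m, q.1), q.2)); split=> [|m b|m b] //=; rewrite ?H0 ?H1.
Qed.


(** Let [C] be a disk in [X] with boundary [u].  The disk [V] and the image of [C]
    form a sphere [d] in [Y], which lifts to a sphere [e] in [X] up to a based
    homotopy [G].  The lift of [V] runs along the chords of the upper half of [e], then
    back along those of its lower half, and then along those of [C].  Its image in [Y]
    is deformed to [V] in three stages: [M1] applies [G], [M2] cancels the way back
    over the image of [C] against the way forth, and [M3] straightens the chords of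
    [V] into radii. *)
Lemma disk_lift n (u : nat -> sph R n.+1 -> X) (V : nat -> disk R n.+1 -> Y) :
  smap u -> smap V -> (forall m b, V m (sph_disk b) = f (u m b)) ->
  exists2 ut : nat -> disk R n.+1 -> X, smap ut /\ (forall m b, ut m (sph_disk b) = u m b)
  & exists W : nat -> disk R n.+1 * I -> Y,
    [/\ smap W, forall m x, W m (x, unitI0 R) = f (ut m x),
      forall m x, W m (x, unitI1 R) = V m x &
      forall m b t, W m (sph_disk b, t) = f (u m b)].
Proof.
move=> su sV Vu; pose e0 := sph_base R n.
have [U [sU U1 U0]] := sphere_contractible su sV Vu.
pose a : Next -> X := fun m => u m e0.
have ea : exterior_map a by exact: smap_ray.
pose C : nat -> disk R n.+1 -> X := fun m x => cone (fun m q => U m q.1) m (x, unitI0 R).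
have sC : smap C.
  apply: (smap_precomp (h := fun x => (x, unitI0 R))); first by ct.
  apply: smap_cone; last by move=> m b b' s /=; rewrite !U0.
  by apply: (smap_precomp (h := fst) _ sU); exact: ct_fst.
have Cu m b : C m (sph_disk b) = u m b by rewrite /C cone_sph U1.
pose d : extSph R n.+2 -> Y := fun p =>
  if set_val p.2 0 ord_max <= 0 then f (C p.1 (proj p.2)) else V p.1 (proj p.2).
have dequator m (x : sph R n.+2) :
    set_val x 0 ord_max = 0 -> f (C m (proj x)) = V m (proj x).
  by move=> /proj_equator [b ->]; rewrite Cu Vu.
have cp := @ct_proj n; have cS := @compact_sph R n.+2.
have dN m z : d (m, hemi (-1) z) = f (C m z).
  rewrite /d /= hemi_last ?sqrrN ?expr1n // proj_hemi ?sqrrN ?expr1n //.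
  by rewrite mulN1r oppr_le0 sqrtr_ge0.
have dP m z : d (m, hemi 1 z) = V m z.
  have h1 : set_val (hemi 1 z) 0 ord_max = Num.sqrt (1 - sqnorm (set_val z)).
    by rewrite hemi_last ?expr1n // mul1r.
  rewrite /d /=; case: ifP => h0; last by rewrite proj_hemi ?expr1n.
  rewrite dequator ?proj_hemi ?expr1n //.
  by apply/eqP; rewrite eq_le h0 h1 sqrtr_ge0.
have bd : based_map (f \o a) d.
  split=> [|m]; last by rewrite -(hemi_base n (expr1n _ _)) dP Vu.
  apply/smapP => //; apply: (smap_if (a := fun x : sph R n.+2 => set_val x 0 ord_max)).
  - by ct.
  - by apply: smap_comp ef _; exact: smap_precomp cp sC.
  - exact: smap_precomp cp sV.
  - by move=> m x; exact: dequator.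
have [e be [G [/smap_htpyP-/(_ cS) sG G0 G1] Gb]] := f_surj.2 n a d ea bd.
have [/smapP-/(_ cS) se eb] := be.
pose Q : topologicalType := ((sph R n.+1 * I) * I)%type.
pose back (q : sph R n.+1 * I) := (q.1, clamp (1 - set_val q.2)).
pose Ep : nat -> Q -> X := fun m q => e (m, hemi 1 (chord q.1)).
pose Em : nat -> Q -> X := fun m q => e (m, hemi (-1) (chord (back q.1))).
pose Ch : nat -> Q -> X := fun m q => C m (chord q.1).
pose p := pcat Ep (pcat Em Ch).
pose Gp : nat -> Q -> Y := fun m q => G ((m, hemi 1 (chord q.1)), q.2).
pose Gm : nat -> Q -> Y := fun m q => G ((m, hemi (-1) (chord (back q.1))), q.2).
pose fC : nat -> Q -> Y := fun m q => f (C m (chord q.1)).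
pose M1 := pcat Gp (pcat Gm fC).
pose Vc : nat -> Q -> Y := fun m q => V m (chord q.1).
pose N : nat -> Q -> Y := fun m q =>
  f (C m (chord (q.1.1, clamp (Num.max `|2 * set_val q.1.2 - 1| (set_val q.2))))).
pose M2 := pcat Vc N.
pose M3 : nat -> Q -> Y := fun m q => V m (to_disk
  ((1 - set_val q.2) *: set_val (chord (q.1.1, clamp (2 * set_val q.1.2)))
   + (set_val q.2 * set_val q.1.2) *: set_val q.1.1)).
pose M := scat M1 (scat M2 M3).
have cc := @ct_chord n.
have c1 : continuous (@hemi n 1) by apply: ct_hemi; rewrite expr1n.
have c2 : continuous (@hemi n (-1)) by apply: ct_hemi; rewrite sqrrN expr1n.
have cb : continuous back by rewrite /back; ct.
have sEp : smap Ep.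
  by apply: (smap_precomp (h := fun q : Q => hemi 1 (chord q.1)) _ se); ct.
have sEm : smap Em.
  by apply: (smap_precomp (h := fun q : Q => hemi (-1) (chord (back q.1))) _ se); ct.
have sCh : smap Ch.
  by apply: (smap_precomp (h := fun q : Q => chord q.1) _ sC); ct.
have sGp : smap Gp.
  by apply: (smap_precomp (h := fun q : Q => (hemi 1 (chord q.1), q.2)) _ sG); ct.
have sGm : smap Gm.
  apply: (smap_precomp (h := fun q : Q => (hemi (-1) (chord (back q.1)), q.2)) _ sG).
  by ct.
have sfC : smap fC by exact: smap_comp sCh.
have sVc : smap Vc.
  by apply: (smap_precomp (h := fun q : Q => chord q.1) _ sV); ct.
have sN : smap N.
  apply: smap_comp ef _; apply: (smap_precomp (h := fun q : Q => chord (q.1.1,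
    clamp (Num.max `|2 * set_val q.1.2 - 1| (set_val q.2)))) _ sC).
  by ct.
have sM3 : smap M3.
  apply: (smap_precomp (h := fun q : Q => to_disk
  ((1 - set_val q.2) *: set_val (chord (q.1.1, clamp (2 * set_val q.1.2)))
   + (set_val q.2 * set_val q.1.2) *: set_val q.1.1)) _ sV).
  by ct.
have e1 eps m : eps ^+ 2 = 1 -> e (m, hemi eps (sph_disk e0)) = a m.
  by move=> /hemi_base ->; rewrite eb.
have sq1 : (1 : R) ^+ 2 = 1 by rewrite expr1n.
have sqN1 : (-1 : R) ^+ 2 = 1 by rewrite sqrrN expr1n.
have back0 b : back (b, unitI0 R) = (b, unitI1 R).
  by rewrite /back /= unitI0E subr0 clamp_ge1.
have back1 b : back (b, unitI1 R) = (b, unitI0 R).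
  by rewrite /back /= unitI1E subrr clamp_le0.
have sp : smap p.
  apply: smap_pcat => // [|m b s].
    apply: smap_pcat => // m b s.
    by rewrite /Em /Ch /= back1 !chord0 e1 // Cu.
  by rewrite pcat0 /Ep /Em /= back0 !chord1 [in RHS]hemi_sph.
have sM1 : smap M1.
  apply: smap_pcat => // [|m b s].
    apply: smap_pcat => // m b s.
    by rewrite /Gm /fC /= back1 !chord0 hemi_base // Gb Cu.
  by rewrite pcat0 /Gp /Gm /= back0 !chord1 [in RHS]hemi_sph.
have N0 m b s : N m ((b, unitI0 R), s) = f (u m b).
  rewrite /N /= unitI0E mulr0 sub0r normrN normr1 clamp_ge1 ?chord1 ?Cu //.
  by rewrite le_max lexx.
have N1 m b s : N m ((b, unitI1 R), s) = f (u m b).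
  rewrite /N /= unitI1E clamp_ge1 ?chord1 ?Cu // le_max.
  by rewrite mulr1 ger0_norm; lra.
have sM2 : smap M2.
  by apply: smap_pcat => // m b s; rewrite N0 /Vc /= chord1 Vu.
have M12 m k : M1 m (k, unitI1 R) = M2 m (k, unitI0 R).
  rewrite /M1 /M2; apply: eq_pcat => //= -[b l].
    by rewrite /Gp /Vc /= G1 dP.
  have l0 := unitI_ge0 l; have l1 := unitI_le1 l.
  rewrite /N /pcat /scat /=; case: ifP => l2.
    rewrite /Gm /= G1 dN /back /=; congr (f (C m (chord (b, _)))).
    rewrite unitI0E set_val_clamp; last by lra.
    rewrite max_l // ler0_norm; last by lra.
    by congr clamp; ring.
  rewrite /fC /=; congr (f (C m (chord (b, clamp _)))).
  by rewrite unitI0E max_l // ger0_norm //; lra.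
have M23 m k : M2 m (k, unitI1 R) = M3 m (k, unitI0 R).
  case: k => b l; have l0 := unitI_ge0 l; have l1 := unitI_le1 l.
  rewrite /M3 /= unitI0E subr0 scale1r mul0r scale0r addr0 to_diskK.
  rewrite /M2 /pcat /scat /=; case: ifP => l2; first by [].
  rewrite /N /= unitI1E (@clamp_ge1 R (Num.max _ _)); last by rewrite le_max lexx orbT.
  by rewrite (@clamp_ge1 R (2 * set_val l)) ?chord1 ?Cu ?Vu //; lra.
have sM : smap M.
  apply: (smap_scat sM1); first exact: (smap_scat sM2 sM3 M23).
  by move=> m k; rewrite scat0 M12.
have M0 m b b' s : M m ((b, unitI0 R), s) = M m ((b', unitI0 R), s).
  rewrite /M /scat /=; case: ifP => _.
    by rewrite /M1 !pcat0 /Gp /= !chord0.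
  case: ifP => _; first by rewrite /M2 !pcat0 /Vc /= !chord0.
  by rewrite /M3 /= unitI0E mulr0 (clamp_le0 (lexx 0)) !chord0 mulr0 !scale0r !addr0.
have M_1 m b s : M m ((b, unitI1 R), s) = f (u m b).
  rewrite /M /scat /=; case: ifP => _.
    by rewrite /M1 !pcat1 /fC /= chord1 Cu.
  case: ifP => _; first by rewrite /M2 pcat1 N1.
  rewrite /M3 /= unitI1E !mulr1 (@clamp_ge1 R 2) ?chord1; last by lra.
  rewrite (_ : set_val (sph_disk b) = set_val b) //.
  by rewrite -scalerDl subrK scale1r to_disk_sph Vu.
exists (fun m x => cone p m (x, unitI0 R)).
  split=> [|m b]; last by rewrite cone_sph /p !pcat1 /Ch /= chord1 Cu.
  apply: (smap_precomp (h := fun x => (x, unitI0 R))); first by ct.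
  by apply: smap_cone => // j b b' s; rewrite /p !pcat0 /Ep /= !chord0.
exists (cone M); split.
- exact: smap_cone sM M0.
- move=> m x; rewrite /cone /M scat0 /= /p /M1 /pcat /scat /=.
  case: ifP => _; first by rewrite /Gp /Ep /= G0.
  by case: ifP => _ //; rewrite /Gm /Em /= G0.
- move=> m x; rewrite /cone /M !scat1 /M3 /= unitI1E subrr scale0r add0r mul1r.
  rewrite set_val_clamp; last by rewrite norm2_ge0 norm2_le1 disk_le1.
  by rewrite norm2_to_sph to_diskK.
- by move=> m b t; rewrite cone_sph M_1.
Qed.

End lifting.

End help.

Section relative_lifting.
Variable R : realType.
Local Notation I := (unitI R).

Variables (X Y : extSpace) (f : X -> Y).
Hypothesis ef : exterior_map f.
Hypothesis f_inj : pi_injective R f.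
Hypothesis f_surj : pi_surjective R f.

Lemma disk0_eq (x y : disk R 0) : x = y.
Proof. by apply: val_inj; apply/rowP => -[]. Qed.

Lemma sph0_empty (b : sph R 0) : False.
Proof.
by have := sph_eq1 b; rewrite /sqnorm big_ord0 => /eqP; rewrite eq_sym oner_eq0.
Qed.

(** For [k = 0] the sphere is empty and the disk is a point, so the property is
    surjectivity on homotopy classes of discrete rays. *)
Lemma help_point (u : nat -> sph R 0 -> X) (v : nat -> disk R 0 -> Y)
    (w : nat -> sph R 0 * I -> Y) : smap v ->
  exists2 ut : nat -> disk R 0 -> X,
    smap ut /\ (forall m b, ut m (sph_disk b) = u m b)
  & exists wt : nat -> disk R 0 * I -> Y,
    [/\ smap wt, forall m x, wt m (x, unitI0 R) = f (ut m x),
      forall m x, wt m (x, unitI1 R) = v m x &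
      forall m b t, wt m (sph_disk b, t) = w m (b, t)].
Proof.
move=> sv; pose x0 : disk R 0 := to_disk 0.
have [a ea [H [/smapP-/(_ (@compact_unitI R)) sH H0 H1]]] :=
  f_surj.1 _ (smap_ray x0 sv).
exists (fun m _ => a m).
  split=> [|m b]; last by case: (sph0_empty b).
  split=> [m|E eE]; first exact: ct_cst.
  by have [m0 Hm] := (Next_mapP _).1 ea E eE; exists m0 => m mm0 _; exact: Hm.
exists (fun m q => H (m, q.2)); split=> [|m x|m x|m b] //=.
- by apply: (smap_precomp (h := snd) _ sH); exact: ct_snd.
- by rewrite H1 (disk0_eq x x0).
- by case: (sph0_empty b).
Qed.

(** The disk [v] and the cylinder [w] around its boundary form a larger disk [V] with
    boundary [f \o u].  A lift of [V] relative to its boundary gives the result, because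
    the cylinder over the disk, with its side flattened onto the top, is again a
    cylinder. *)
Lemma pi_bijective_help : help_property R f.
Proof.
case=> [|n] u v w su sv sw w0 w1; first exact: help_point.
pose P : nat -> (sph R n.+1 * I) * I -> Y := fun m q =>
  if set_val q.1.2 <= 2^-1 then v m (to_disk ((2 * set_val q.1.2) *: set_val q.1.1))
  else w m (q.1.1, clamp (2 - 2 * set_val q.1.2)).
have sP : smap P.
  apply: (smap_if (a := fun q : (sph R n.+1 * I) * I => set_val q.1.2)); first by ct.
  - apply: (smap_precomp (h := fun q : (sph R n.+1 * I) * I =>
      to_disk ((2 * set_val q.1.2) *: set_val q.1.1)) _ sv).
    by ct.
  - apply: (smap_precomp (h := fun q : (sph R n.+1 * I) * I =>
      (q.1.1, clamp (2 - 2 * set_val q.1.2))) _ sw).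
    by ct.
  - move=> m [[b l] s] /= ->; rewrite mulfV // scale1r to_disk_sph clamp_ge1 ?w1 //.
    by lra.
have P0 m b b' s : P m ((b, unitI0 R), s) = P m ((b', unitI0 R), s).
  by rewrite /P /= unitI0E invr_ge0 ler0n mulr0 !scale0r.
pose V : nat -> disk R n.+1 -> Y := fun m x => cone P m (x, unitI0 R).
have sV : smap V.
  apply: (smap_precomp (h := fun x => (x, unitI0 R))); first by ct.
  exact: smap_cone sP P0.
have Vw m b t : V m (to_disk ((1 - set_val t / 2) *: set_val b)) = w m (b, t).
  have t0 := unitI_ge0 t; have t1 := unitI_le1 t.
  have nb : norm2 ((1 - set_val t / 2) *: set_val b) = 1 - set_val t / 2.
    by rewrite norm2Z ?(norm2_eq1 (sph_eq1 b)) ?mulr1 //; lra.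
  have bd : sqnorm ((1 - set_val t / 2) *: set_val b) <= 1.
    by rewrite -norm2_le1 nb; lra.
  rewrite /V /cone /P /= set_val_to_disk // nb to_sphZ; last by lra.
  rewrite set_val_clamp; last by lra.
  case: ifP => t2.
    have te : set_val t = 1 by lra.
    have -> : t = unitI1 R by rewrite -(clampK t) te clamp_ge1.
    rewrite w1 unitI1E (_ : 2 * (1 - 1 / 2) = 1) ?scale1r ?to_disk_sph //.
    by field.
  rewrite (_ : 2 - 2 * (1 - set_val t / 2) = set_val t) ?clampK //; by field.
have Vu m b : V m (sph_disk b) = f (u m b).
  by rewrite -w0 -Vw unitI0E mul0r subr0 scale1r to_disk_sph.
have Vv m x : V m (to_disk (2^-1 *: set_val x)) = v m x.
  have x1 : norm2 (set_val x) <= 1 by rewrite norm2_le1 disk_le1.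
  have x0 := norm2_ge0 (set_val x).
  have n2 : norm2 (2^-1 *: set_val x) = 2^-1 * norm2 (set_val x).
    by rewrite norm2Z // invr_ge0.
  have xd : sqnorm (2^-1 *: set_val x) <= 1 by rewrite -norm2_le1 n2; lra.
  rewrite /V /cone /P /= set_val_to_disk // n2.
  rewrite set_val_clamp; last by lra.
  rewrite ifT; last by lra.
  rewrite -n2 -scalerA norm2_to_sph scalerA mulfV ?scale1r ?to_diskK //.
have [ut [sut utu] [W [sW W0 W1 Wr]]] := disk_lift ef f_inj f_surj su sV Vu.
exists ut => //.
pose th (q : disk R n.+1 * I) : disk R n.+1 :=
  to_disk ((1 - set_val q.2 / 2) *: set_val q.1).
(* In the square with coordinates [norm2 x] and [t], the time [sg] is 0 on the bottom
   and 1 on the side, so it jumps at their common corner.  There [th] lies on the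
   boundary of the disk, where [W] does not depend on time. *)
pose den (q : disk R n.+1 * I) : R := 1 - norm2 (set_val q.1) * (1 - set_val q.2).
pose sg (q : disk R n.+1 * I) : I := clamp (set_val q.2 / den q).
have cth : continuous th by rewrite /th; ct.
have cden : continuous den by rewrite /den; ct.
exists (fun m q => W m (th q, sg q)); split.
- split=> [m|E /(sW.2) [m0 H]]; last by exists m0 => m mm0 q; exact: H.
  apply: ct_tube => //; [exact: compact_unitI|exact: sW.1|].
  move=> [x t]; have [d0|d0] := eqVneq (den (x, t)) 0; last first.
    left; rewrite /sg.
    have cc := @ct_clamp R R id (@ct_id _).
    apply: (@continuous_comp _ _ _ (fun q : disk R n.+1 * I => set_val q.2 / den q)
      (fun r : R => clamp r)); last exact: cc.
    apply: continuousM; first exact: (ct_comp (@ct_set_val _ _) (@ct_snd _ _)).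
    by apply: continuousV => //; exact: cden.
  right=> c; move: d0; rewrite /den /= => d0.
  have t0 := unitI_ge0 t; have t1 := unitI_le1 t.
  have x1 : norm2 (set_val x) <= 1 by rewrite norm2_le1 disk_le1.
  have x0 := norm2_ge0 (set_val x).
  have xe : norm2 (set_val x) = 1 by nra.
  have te : set_val t = 0 by nra.
  have -> : th (x, t) = sph_disk (to_sph (set_val x)).
    rewrite /th /= te mul0r subr0 scale1r -to_disk_sph; congr to_disk.
    by rewrite -[LHS]norm2_to_sph xe scale1r.
  by rewrite !Wr.
- move=> m x; rewrite /th /sg /= unitI0E !mul0r subr0 scale1r to_diskK.
  by rewrite (clamp_le0 (lexx 0)) W0.
- move=> m x; rewrite /th /sg /den /= unitI1E subrr mulr0 subr0 divr1.
  rewrite (clamp_ge1 (lexx 1)) W1 (_ : 1 - 1 / 2 = 2^-1) ?Vv //.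
  by field.
- move=> m b t.
  rewrite /th /sg /den /= (_ : set_val (sph_disk b) = set_val b) //.
  rewrite (norm2_eq1 (sph_eq1 b)) mul1r.
  rewrite (_ : 1 - (1 - set_val t) = set_val t); last by ring.
  have [t0|t0] := eqVneq (set_val t) 0.
    rewrite t0 mul0r subr0 scale1r to_disk_sph Wr -w0; congr (w m (b, _)).
    by rewrite -(clampK t) t0 clamp_le0.
  by rewrite mulfV // clamp_ge1 // W1 Vw.
Qed.

End relative_lifting.

(** * The mapping path space *)

Section weak_hausdorff.

(** The image under [b] of a closed subset of [L] is closed.  If [a k0 = b l1] differs
    from [b l0], normality of [L] separates the fibres of [b] over these two values;
    the image of the complement of the first neighbourhood is closed, and its
    preimage under [a] misses [k0]. *)
Lemma weakly_hausdorff_equalizer (R : realType) (X K L : topologicalType)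
    (a : K -> X) (b : L -> X) :
  weakly_hausdorff X -> compact [set: K] -> hausdorff_space K ->
  compact [set: L] -> hausdorff_space L -> continuous a -> continuous b ->
  open [set p : K * L | a p.1 <> b p.2].
Proof.
move=> wX cK hK cL hL ca cb.
have closed_image (A : set L) : closed A -> closed (b @` A).
  move=> cA.
  have cA' : compact A by apply: subclosed_compact cA cL _.
  have -> : b @` A = range (fun z : set_type A => b (set_val z)).
    apply/seteqP; split=> [_ [x Ax <-]|_ [z _ <-]].
      by exists (exist _ x (mem_set Ax)).
    by exists (set_val z) => //; exact: set_valP.
  apply: wX; [exact: compact_subtype|exact: set_val_hausdorff|].
  exact: (ct_comp cb (@ct_set_val _ _)).
have closed_point (l : L) : closed [set b l].
  rewrite -image_set1; apply: closed_image.
  by apply: compact_closed => //; exact: compact_set1.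
rewrite openE => -[k0 l0] /= kl.
pose B := b @^-1` [set b l0].
have cB : closed B by apply: closed_comp (closed_point l0) => x _; exact: cb.
(* When [a k0] is not a value of [b], any neighbourhood of [l0] will do. *)
have [[l1 al1]|nal] := pselect (exists l1, a k0 = b l1); last first.
  exists (a @^-1` (~` (b @` setT)), setT); last first.
    by move=> [k l] [/= Hk _] kl'; apply: Hk; exists l.
  split=> /=; last exact: filterT.
  apply: open_nbhs_nbhs; split.
    apply: open_comp; first by move=> x _; exact: ca.
    by apply: closed_openC; apply: closed_image; exact: closedT.
  by move=> [l _ bl]; apply: nal; exists l.
pose A := b @^-1` [set b l1].
have cA : closed A by apply: closed_comp (closed_point l1) => x _; exact: cb.
have AB : A `&` B = set0.
  apply/seteqP; split=> // x [/= Ax Bx]; apply: kl.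
  by rewrite al1 -Ax -Bx.
have nL : normal_space L by exact: compact_normal.
have [U [V [oU oV AU BV UV]]] : exists U V : set L,
    [/\ open U, open V, A `<=` U, B `<=` V & U `&` V = set0].
  by move/(@normal_openP R) : nL; apply.
exists (a @^-1` (~` (b @` (~` U))), V).
  split=> /=; last by apply: open_nbhs_nbhs; split=> //; apply: BV.
  apply: open_nbhs_nbhs; split.
    apply: open_comp; first by move=> x _; exact: ca.
    by apply: closed_openC; apply: closed_image; exact: open_closedC.
  by move=> [l nUl bl]; apply: nUl; apply: AU; rewrite /A /= bl.
move=> [k l] [/= Hk Vl] kl'; apply: Hk; exists l => // Ul.
by have : (U `&` V) l by []; rewrite UV.
Qed.

End weak_hausdorff.

Section mapping_path_space.
Variable R : realType.
Local Notation I := (unitI R).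

Section topology.
Variables (X Y : topologicalType) (f : X -> Y).

Record mpath := MPath {
  origin : X;
  track : I -> Y;
  ct_track : continuous track;
  track0 : track (unitI0 R) = f origin }.

Lemma mpath_eq (p q : mpath) : origin p = origin q -> track p = track q -> p = q.
Proof.
case: p q => [x c cc c0] [y d cd d0] /= xy ed; subst y d.
by congr MPath; exact: Prop_irrelevance.
Qed.

HB.instance Definition _ := gen_eqMixin mpath.
HB.instance Definition _ := gen_choiceMixin mpath.

Definition mpath_family (K : topologicalType) (u : K -> mpath) : Prop :=
  continuous (fun k => origin (u k)) /\
  continuous (fun q : K * I => track (u q.1) q.2).

(** The final topology for the families over compact Hausdorff spaces, which makes
    the space compactly generated by construction. *)
Definition mpath_open : set (set mpath) := fun A =>
  forall (K : topologicalType) (u : K -> mpath), compact [set: K] ->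
    hausdorff_space K -> mpath_family u -> open (u @^-1` A).

Lemma mpath_openT : mpath_open setT.
Proof. by move=> K u _ _ _; rewrite preimage_setT; exact: openT. Qed.

Lemma mpath_openI : setI_closed mpath_open.
Proof.
move=> A B oA oB K u cK hK fu; rewrite preimage_setI.
by apply: openI; [exact: oA|exact: oB].
Qed.

Lemma mpath_open_bigU (J : Type) (A : J -> set mpath) :
  (forall j, mpath_open (A j)) -> mpath_open (\bigcup_j A j).
Proof.
move=> oA K u cK hK fu; rewrite preimage_bigcup.
by apply: bigcup_open => j _; exact: oA.
Qed.

HB.instance Definition _ :=
  isOpenTopological.Build mpath mpath_openT mpath_openI mpath_open_bigU.

Lemma mpath_openE (A : set mpath) : open A = mpath_open A. Proof. by []. Qed.

Lemma mpath_family_continuous (K : topologicalType) (u : K -> mpath) :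
  compact [set: K] -> hausdorff_space K -> mpath_family u -> continuous u.
Proof. by move=> cK hK fu; apply/continuousP => A oA; exact: oA. Qed.

Lemma ct_origin : continuous origin.
Proof.
apply/continuousP => O oO; rewrite mpath_openE => K u _ _ [cu _].
by move/continuousP : cu => /(_ O oO).
Qed.

(** By the tube lemma the topology refines the compact-open topology. *)
Lemma mpath_open_on (J : set I) (O : set Y) : compact J -> open O ->
  open [set p : mpath | forall t, J t -> O (track p t)].
Proof.
move=> cJ oO; rewrite mpath_openE => K u _ _ [_ cu]; rewrite openE => k Hk.
have /compact_near_coveringP/(_ K (nbhs k)
  (fun k t => O (track (u k) t)) (nbhs_filter _)) near_cover := cJ.
have : nbhs k (fun k => J `<=` (fun t => O (track (u k) t))).
  apply: near_cover => t Jt; have nO : nbhs (track (u k) t) O.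
    by apply: open_nbhs_nbhs; split=> //; exact: Hk.
  have [[U V] /= [nU nV] UV] := cu (k, t) _ nO.
  by exists (V, U) => // -[t' k'] [/= Vt Uk]; exact: (UV (k', t')).
by move=> H; apply: (nbhsS H) => k' Hk' t /Hk'.
Qed.

(** Since [I] is locally compact, evaluation is continuous already for the
    compact-open topology. *)
Lemma ct_eval : continuous (fun q : mpath * I => track q.1 q.2).
Proof.
move=> [p t] A /=; rewrite nbhsE => /= nA; case: nA => O [oO Ot] OA.
have nt : nbhs t (track p @^-1` O).
  by apply: (@ct_track p t); apply: open_nbhs_nbhs; split.
have [J nJ JO] : exists2 J : set I, nbhs t J & (closure J `<=` track p @^-1` O).
  have [|J nJ JA] := @compact_regular I t setT (@hausdorff_unitI R)
    (@compact_unitI R) _ _ nt.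
    exact: filterT.
  by exists J.
have cJ : compact (closure J).
  apply: subclosed_compact (@compact_unitI R) _ => //; exact: closed_closure.
have nV : nbhs p [set p' : mpath | forall s, closure J s -> O (track p' s)].
  by apply: open_nbhs_nbhs; split; [exact: mpath_open_on|exact: JO].
exists ([set p' : mpath | forall s, closure J s -> O (track p' s)], J) => //.
by move=> [p' s] [/= Hp Js]; apply: OA; apply: Hp; exact: subset_closure.
Qed.

Lemma ct_track_at (t : I) : continuous (fun p : mpath => track p t).
Proof.
by apply: (ct_comp (f := fun p : mpath => (p, t)) ct_eval); ct.
Qed.

Lemma mpath_compactly_generated : compactly_generated mpath.
Proof.
move=> A HA; rewrite -[A]setCK; apply: open_closedC; rewrite mpath_openE => K u cK hK fu.
rewrite preimage_setC; apply: closed_openC; apply: HA => //.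
exact: mpath_family_continuous.
Qed.

Lemma mpath_into_continuous (Z : topologicalType) (u : Z -> mpath) :
  compactly_generated Z -> mpath_family u -> continuous u.
Proof.
move=> cgZ [cu cu']; apply/continuous_closedP => A cA; apply: cgZ => K v cK hK cv.
have cuv : continuous (u \o v).
  apply: mpath_family_continuous => //; split; first exact: (ct_comp cu cv).
  by apply: (ct_comp (f := fun q : K * I => (v q.1, q.2)) cu'); ct.
by move/continuous_closedP : cuv => /(_ A cA).
Qed.

(** Two distinct points of the path space differ in their origin or at some time of
    their track, so weak Hausdorffness of [X] or of [Y] separates them over compact
    test spaces. *)
Lemma mpath_weakly_hausdorff :
  weakly_hausdorff X -> weakly_hausdorff Y -> weakly_hausdorff mpath.
Proof.
move=> wX wY K u cK hK cu.
rewrite -[range u]setCK; apply: open_closedC; rewrite mpath_openE => L v cL hL fv.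
have cv := mpath_family_continuous cL hL fv.
rewrite openE => l nl.
have /compact_near_coveringP/(_ L (nbhs l)
  (fun l k => u k <> v l) (nbhs_filter _)) near_cover := cK.
have H : nbhs l (fun l => [set: K] `<=` (fun k => u k <> v l)).
  apply: near_cover => k _; have kl : u k <> v l by move=> kl; apply: nl; exists k.
  suff [W [oW Wkl HW]] : exists W : set (K * L),
      [/\ open W, W (k, l) & forall k l, W (k, l) -> u k <> v l].
    have : nbhs (k, l) W by exact: open_nbhs_nbhs.
    move=> [[U V] /= [nU nV] UV]; exists (U, V) => //.
    by move=> [k' l'] [/= Uk Vl]; apply: HW; exact: UV.
  have [same|diff] := pselect (origin (u k) = origin (v l)); last first.
    exists [set q : K * L | origin (u q.1) <> origin (v q.2)]; split=> //.
      by apply: (@weakly_hausdorff_equalizer R X K L (fun k => origin (u k))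
        (fun l => origin (v l)) wX) => //;
        [exact: (ct_comp ct_origin cu)|exact: (ct_comp ct_origin cv)].
    by move=> k' l' /= + E; rewrite E.
  have [t tne] : exists t, track (u k) t <> track (v l) t.
    apply: contrapT => ntr; apply: kl; apply: mpath_eq => //; apply/funext => t.
    by apply: contrapT => tne; apply: ntr; exists t.
  exists [set q : K * L | track (u q.1) t <> track (v q.2) t]; split=> //.
    by apply: (@weakly_hausdorff_equalizer R Y K L (fun k => track (u k) t)
      (fun l => track (v l) t) wY) => //;
      [exact: (ct_comp (@ct_track_at t) cu)|exact: (ct_comp (@ct_track_at t) cv)].
  by move=> k' l' /= + E; rewrite E.
by apply: (nbhsS H) => l' Hl' [k _ kl]; exact: (Hl' k Logic.I).
Qed.

End topology.

Section externology.
Variables (X Y : extSpace) (f : X -> Y).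
Local Notation P := (mpath f).

(** Uniform control of whole paths: this makes evaluation an exterior homotopy. *)
Definition mpath_exterior : set (set P) := [set W | open W /\
  exists F E, [/\ exterior F, exterior E &
    forall p : P, F (origin p) -> (forall t, E (track p t)) -> W p]].

Lemma mpath_exterior_nonempty : mpath_exterior !=set0.
Proof.
exists setT; split; first exact: openT.
have [F eF] := exterior_nonempty X; have [E eE] := exterior_nonempty Y.
by exists F, E.
Qed.

Lemma mpath_exterior_open W : mpath_exterior W -> open W.
Proof. by case. Qed.

Lemma mpath_exteriorI V W :
  mpath_exterior V -> mpath_exterior W -> mpath_exterior (V `&` W).
Proof.
move=> [oV [F [E [eF eE HV]]]] [oW [F' [E' [eF' eE' HW]]]].
split; first exact: openI.
exists (F `&` F'), (E `&` E'); split; [exact: exteriorI|exact: exteriorI|].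
move=> p [Fp Fp'] EE; split.
  by apply: HV => // t; have [] := EE t.
by apply: HW => // t; have [] := EE t.
Qed.

Lemma mpath_exterior_up V W :
  mpath_exterior V -> open W -> V `<=` W -> mpath_exterior W.
Proof.
move=> [oV [F [E [eF eE HV]]]] oW VW; split=> //.
by exists F, E; split=> // p Fp Ep; apply: VW; exact: HV.
Qed.

Definition mpath_ext : extSpace := ExtSpace mpath_exterior_nonempty
  mpath_exterior_open mpath_exteriorI mpath_exterior_up.

Lemma mpath_CGWH : CGWH X -> CGWH Y -> CGWH mpath_ext.
Proof.
move=> [_ wX] [_ wY]; split; first exact: mpath_compactly_generated.
exact: mpath_weakly_hausdorff.
Qed.

Lemma origin_exterior : exterior_map (@origin X Y f : mpath_ext -> X).
Proof.
split=> [|F eF]; first exact: ct_origin.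
split.
  have /continuousP := @ct_origin X Y f; apply; exact: exterior_open.
by have [E eE] := exterior_nonempty Y; exists F, E.
Qed.

Lemma eval_homotopy : ext_homotopy (fun p : mpath_ext => f (origin p))
  (fun p : mpath_ext => track p (unitI1 R))
  (fun q : extprod mpath_ext I => track q.1 q.2).
Proof.
split=> [|p|//]; last by rewrite /= track0.
apply/exterior_mapP; first exact: compact_unitI; split; first exact: ct_eval.
move=> E eE; exists [set p : P | forall t, E (track p t)]; last by move=> p t; exact.
split; last by have [F eF] := exterior_nonempty X; exists F, E.
have -> : [set p : P | forall t, E (track p t)] =
    [set p : P | forall t, [set: I] t -> E (track p t)].
  by apply/seteqP; split=> p H t // ; exact: H.
by apply: mpath_open_on; [exact: compact_unitI|exact: exterior_open].
Qed.

Lemma endpoint_exterior :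
  exterior_map (fun p : mpath_ext => track p (unitI1 R)).
Proof.
split=> [|E eE]; first exact: ct_track_at.
split.
  have /continuousP := @ct_track_at X Y f (unitI1 R); apply; exact: exterior_open.
have [F eF] := exterior_nonempty X.
by exists F, E; split=> // p _ /(_ (unitI1 R)).
Qed.

Lemma mpath_into_exterior (Z : extSpace) (u : Z -> mpath_ext) : continuous u ->
  exterior_map (fun z => origin (u z)) ->
  (forall E, exterior E -> exists2 G : set Z, exterior G &
     forall z t, G z -> E (track (u z) t)) ->
  exterior_map u.
Proof.
move=> cu [_ eo] et; split=> // W [oW [F [E [eF eE HW]]]].
have [G eG HG] := et E eE.
apply: (exterior_up (exteriorI (eo F eF) eG)).
  by move/continuousP : cu; exact.
by move=> z [Fz Gz]; apply: HW => // t; exact: HG.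
Qed.

(** A lifting problem for the endpoint map consists of the data [u], [v], [w] of the
    homotopy extension and lifting property of [f], and a lift of its solution. *)
Lemma endpoint_trivial_fibration : help_property R f ->
  trivial_fibration R (fun p : mpath_ext => track p (unitI1 R)).
Proof.
move=> hf; split=> [|k u v eu ev uv]; first exact: endpoint_exterior.
have cS := @compact_sph R k; have cD := @compact_disk R k.
have su : smap (fun m b => origin (u (m, b))).
  exact: (smapP (fun q => origin (u q)) cS).1 (exterior_comp eu origin_exterior).
have sv : smap (fun m x => v (m, x)) by exact: (smapP v cD).1.
have [ew _ _] := precomp_homotopy eu eval_homotopy.
have sw := (smap_htpyP _ cS).1 ew.
have [|m b|ut [sut utu] [wt [swt wt0 wt1 wtw]]] :=
  hf k (fun m b => origin (u (m, b))) (fun m x => v (m, x)) _ su sv sw.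
- by move=> m b /=; rewrite track0.
- by have := congr1 (fun g => g (m, b)) uv.
have cwt m x : continuous (fun t => wt m (x, t)).
  by apply: (ct_comp (f := fun t : I => (x, t)) (swt.1 m)); ct.
pose h : extDisk R k -> mpath_ext := fun q => MPath (cwt q.1 q.2) (wt0 q.1 q.2).
exists h; split.
- apply/smapP => //; split=> [m|W [oW [F [E [eF eE HW]]]]].
    apply: mpath_family_continuous => //; first exact: hausdorff_disk.
    split; first exact: sut.1.
    rewrite (_ : (fun q => _) = wt m); first exact: swt.1.
    by apply/funext => -[].
  have [m0 H0] := sut.2 F eF; have [m1 H1] := swt.2 E eE.
  exists (maxn m0 m1) => m; rewrite geq_max => /andP[mm0 mm1] x.
  by apply: HW => [|t] /=; [exact: H0|exact: H1].
- apply/funext => -[m b]; apply: mpath_eq => /=; first exact: utu.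
  by apply/funext => t; rewrite wtw.
- by apply/funext => -[m x] /=; rewrite wt1.
Qed.

End externology.

End mapping_path_space.

(** * Homotopies under the half-line *)

Section under.
Variable R : realType.
Local Notation I := (unitI R).

Lemma htpic_under_sym (X Y : Estar R) (f g : X -> Y) :
  htpic_under f g -> htpic_under g f.
Proof.
move=> [H hH Hs]; exists (hrev H); first exact: hrev_homotopy.
by move=> t s; rewrite /hrev /= Hs.
Qed.

Lemma htpic_under_trans (X Y : Estar R) (f g h : X -> Y) :
  htpic_under f g -> htpic_under g h -> htpic_under f h.
Proof.
move=> [H hH Hs] [H' hH' Hs']; exists (hcat H H'); first exact: hcat_homotopy hH hH'.
by move=> t s; rewrite /hcat /=; case: ifP.
Qed.

Lemma htpic_under_compl (X Y Z : Estar R) (f g : X -> Y) (phi : Y -> Z) :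
  exterior_map phi -> phi \o @sec R Y = @sec R Z ->
  htpic_under f g -> htpic_under (phi \o f) (phi \o g).
Proof.
move=> ephi sphi [H hH Hs]; exists (phi \o H); first exact: comp_homotopy.
by move=> t s /=; rewrite Hs -sphi.
Qed.

Lemma htpic_under_compr (X Y Z : Estar R) (f g : Y -> Z) (u : X -> Y) :
  exterior_map u -> u \o @sec R X = @sec R Y ->
  htpic_under f g -> htpic_under (f \o u) (g \o u).
Proof.
move=> eu su [H hH Hs]; eexists; first exact: precomp_homotopy eu hH.
by move=> t s /=; rewrite -(Hs t) -su.
Qed.

(** Lift the identity of the cofibrant [Y] through the endpoint map of the mapping
    path space, starting from the constant paths on the half-line. *)
Lemma help_right_inverse (X Y : Estar R) (f : X -> Y) :
  exterior_map f -> f \o @sec R X = @sec R Y -> help_property R f ->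
  Estar_cofibrant Y ->
  exists g : Y -> X, [/\ exterior_map g, g \o @sec R Y = @sec R X &
    htpic_under (f \o g) id].
Proof.
move=> ef fs hf [_ cofY].
have fsE s : f (sec X s) = sec Y s by rewrite -fs.
pose u : Rplus R -> mpath_ext R f := fun s =>
  MPath (@ct_cst I _ (f (sec X s))) (erefl (f (sec X s))).
have [csX esX] := sec_exterior X.
have eu : exterior_map u.
  apply: mpath_into_exterior => [||E eE].
  - apply: mpath_into_continuous; first exact: (Rplus_CGWH R).1.
    split=> //=; apply: (ct_comp ef.1).
    by apply: (ct_comp (f := fst) csX); exact: ct_fst.
  - exact: sec_exterior.
  - exists ((f \o @sec R X) @^-1` E) => //.
    by apply: (exterior_comp (sec_exterior X) ef).2.
have square : (fun p : mpath_ext R f => track p (unitI1 R)) \o u = id \o @sec R Y.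
  by apply/funext => s /=; rewrite fsE.
have [h [eh hs hv]] := cofY _ _ _ (mpath_CGWH R f (Estar_CGWH X) (Estar_CGWH Y))
  (Estar_CGWH Y) (endpoint_trivial_fibration hf) u id eu (exterior_map_id _) square.
exists (fun y => origin (h y)); split.
- exact: (exterior_comp eh (origin_exterior R f)).
- apply/funext => s /=.
  by have /(congr1 (fun k => origin (k s))) := hs.
exists (fun q => track (h q.1) q.2).
  have [eH H0 H1] := precomp_homotopy eh (eval_homotopy R f).
  split=> [|y|y]; [exact: eH|exact: H0|].
  by have := congr1 (fun k => k y) hv.
move=> t s /=.
have /(congr1 (fun k => track (k s) t)) /= -> := hs.
exact: fsE.
Qed.

End under.

Theorem theorem3p9 (R : realType) (X Y : Estar R) (f : X -> Y) :
  Estar_map f ->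
  Estar_cofibrant X -> Estar_fibrant X ->
  Estar_cofibrant Y -> Estar_fibrant Y ->
  (weak_equivalence R f <-> htpy_equiv_under f).
Proof.
move=> [ef fs _] cX _ cY _; split; last first.
  move=> [_ _ [g [eg gs [H hH _] [H' hH' _]]]]; apply/weak_equivalenceP => //.
  have egf := exterior_comp ef eg; have efg := exterior_comp eg ef.
  have g_inj := pi_injective_cancel ef (pi_injective_htpy_id hH').
  split; first exact: pi_injective_cancel eg (pi_injective_htpy_id hH).
  exact: pi_surjective_cancel ef eg g_inj (pi_surjective_htpy_id hH egf).
move=> /(weak_equivalenceP R ef) [f_inj f_surj].
have [g [eg gs fg]] :=
  help_right_inverse ef fs (pi_bijective_help ef f_inj f_surj) cY.
have [H hH _] := fg; have efg := exterior_comp eg ef.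
have g_inj := pi_injective_cancel ef (pi_injective_htpy_id hH).
have g_surj := pi_surjective_cancel eg ef f_inj (pi_surjective_htpy_id hH efg).
have [g' [eg' g's gg']] :=
  help_right_inverse eg gs (pi_bijective_help eg g_inj g_surj) cX.
split=> //; exists g; split=> //.
have fg' : htpic_under f g'.
  apply: htpic_under_trans (htpic_under_sym (htpic_under_compl ef fs gg')) _.
  exact: htpic_under_compr eg' g's fg.
exact: htpic_under_trans (htpic_under_compl eg gs fg') gg'.
Qed.
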